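(* Let $p$ be an odd prime, $n\ge 1$, $a\in\mathbb F_{p^n}^*$ and let $\alpha\ge 0$ be an integer. Let $S(ax^{p^\alpha+1},n)=\sum_{x\in\mathbb F_{p^n}}e_n(ax^{p^\alpha+1})$. (i) If $\nu_2(n)\le\nu_2(\alpha)$, then $$S(ax^{p^\alpha+1},n)=\eta(a)(-1)^{n-1}i^{\frac14(p-1)^2n}p^{\frac12n}.$$ (ii) If $\nu_2(n)=\nu_2(\alpha)+1$, then $$S(ax^{p^\alpha+1},n)=\begin{cases}p^{\frac12[n+(2\alpha,n)]}&\text{if } a^{\frac{(p^\alpha-1)(p^n-1)}{p^{(2\alpha,n)}-1}}=-1,\\ -p^{\frac12n}&\text{otherwise.}\end{cases}$$ (iii) If $\nu_2(n)>\nu_2(\alpha)+1$, then $$S(ax^{p^\alpha+1},n)=\begin{cases}-p^{\frac12[n+(2\alpha,n)]}&\text{if } a^{\frac{(p^\alpha-1)(p^n-1)}{p^{(2\alpha,n)}-1}}=1,\\ p^{\frac12n}&\text{otherwise.}\end{cases}$$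
   Context: $e_n(y)=e^{2\pi i\,\mathrm{Tr}_n(y)/p}$ for $y\in\mathbb F_{p^n}$, where $\mathrm{Tr}_n$ is the absolute trace $\mathbb F_{p^n}\to\mathbb F_p$. $\nu_2$ is the $2$-adic order, with $\nu_2(0)=\infty$. $(u,v)$ denotes the greatest common divisor of $u$ and $v$. $\eta$ denotes the quadratic character of $\mathbb F_{p^n}$ ($\eta(a)=1$ if $a$ is a nonzero square in $\mathbb F_{p^n}$, and $-1$ if it is a nonsquare). In $i^{\frac14(p-1)^2n}$, $i=\sqrt{-1}$. *)

(* Defs.v *)
From HB Require Import structures.
From mathcomp Require Import all_boot all_order all_algebra all_field.
From mathcomp Require Import complex.
From mathcomp Require Import all_classical all_reals all_analysis.

Set Implicit Arguments.
Unset Strict Implicit.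
Unset Printing Implicit Defensive.

Import Order.TTheory GRing.Theory Num.Theory.

Local Open Scope ring_scope.
Local Open Scope complex_scope.

(* 2-adic order; [logn 2 0 = 0], hence the separate case for 0. *)
Definition nu2 (m : nat) : \bar int :=
  if m == 0%N then +oo%E else (logn 2 m)%:Z%:E.

Definition cexp (R : realType) (z : R[i]) : R[i] :=
  (expR (complex.Re z))%:C * (cos (complex.Im z) +i* sin (complex.Im z)).

(* In a field with p ^ n elements the sum of the conjugates lies in the prime
   subfield; [abs_trace] is the corresponding element of 'F_p, see [abs_traceE]
   below. *)
Definition abs_trace (F : finFieldType) (p n : nat) (y : F) : 'F_p :=
  odflt 0 [pick c : 'F_p | (c : nat)%:R == \sum_(i < n) y ^+ (p ^ i)].

(* y |-> e^(2 pi i Tr(y) / p); the representative of Tr(y) is taken in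
   {0, ..., p - 1}. *)
Definition add_char (R : realType) (F : finFieldType) (p n : nat) (y : F) :
    R[i] :=
  cexp (2 * (pi : R)%:C * 'i%C * (abs_trace p n y : nat)%:R / p%:R).

Definition exp_sum (R : realType) (F : finFieldType) (p n : nat)
    (f : F -> F) : R[i] :=
  \sum_(x : F) add_char R p n (f x).

Definition quad_char (F : finFieldType) (a : F) : int :=
  if a == 0 then 0 else if [exists b : F, a == b ^+ 2] then 1 else -1.

Lemma abs_traceE (F : finFieldType) (p n : nat) (y : F) :
  prime p -> #|F| = (p ^ n)%N ->
  (abs_trace p n y : nat)%:R = \sum_(i < n) y ^+ (p ^ i).
Proof.
move=> p_pr cardF; rewrite /abs_trace; case: pickP => [c /eqP //|noc].
have n_gt0 : (0 < n)%N.
  by case: n cardF {noc} => // cF; have := finNzRing_gt1 F; rewrite cF.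
have chF := card_finPcharP cardF p_pr.
set t := \sum_(i < n) _ in noc *.
have tp : t ^+ p = t.
  rewrite -(pFrobenius_autE chF) rmorph_sum /=.
  under eq_bigr do rewrite pFrobenius_autE -exprM -expnSr.
  have -> : n = n.-1.+1 by rewrite prednK.
  rewrite big_ord_recr /= /t -[in RHS](prednK n_gt0) big_ord_recl /=.
  by rewrite prednK // -cardF expf_card expn0 expr1 addrC.
pose P : {poly F} := 'X^p - 'X.
have p_gt1 := prime_gt1 p_pr.
have szP : size P = p.+1.
  by rewrite size_polyDl ?size_polyXn // size_polyN size_polyX ltnS.
have P0 : P != 0 by rewrite -size_poly_gt0 szP.
pose s := t :: [seq (c : nat)%:R | c : 'F_p].
have : (size s < size P)%N.
  apply: max_poly_roots => //.
    rewrite /= /root !hornerE tp subrr eqxx /=.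
    apply/allP => _ /mapP[c _ ->]; rewrite /root !hornerE.
    by rewrite -(pFrobenius_autE chF) rmorph_nat subrr.
  rewrite /= map_inj_in_uniq ?enum_uniq.
    rewrite andbT; apply/mapP => -[c _ tc].
    by have := noc c; rewrite -tc eqxx.
  move=> c d _ _ /= cd; apply/val_inj => /=.
  have lt (e : 'F_p) : (e < p)%N.
    by rewrite -[X in (_ < X)%N](Fp_cast p_pr); exact: ltn_ord.
  move: cd; wlog le : c d / (c <= d)%N.
    move=> H cd; case/orP: (leq_total c d) => le; first exact: H.
    by apply/esym; apply: H.
  move/eqP; rewrite eq_sym -subr_eq0 -natrB // -(dvdn_pcharf chF) => dv.
  apply/eqP; rewrite eqn_leq le /= -subn_eq0 -leqn0 leqNgt; apply/negP => pos.
  by have := dvdn_leq pos dv; rewrite leqNgt (leq_ltn_trans (leq_subr _ _)).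
by rewrite szP /= size_map -cardE card_Fp // ltnn.
Qed.

(* Main.v *)
Require Import Defs.
From HB Require Import structures.
From mathcomp Require Import all_boot all_order all_algebra all_field.
From mathcomp Require Import complex.
From mathcomp Require Import all_classical all_reals all_analysis.
From mathcomp Require Import fintype finset fingroup perm cyclic ring lra zify.

(* Write [q = p ^ n], [m = gcdn alpha n] and [Q = p ^ m]. The sum [S] only depends
   on the gcd of the exponent [p ^ alpha + 1] with [q - 1], which is [2] in case
   (i) and [Q + 1] in cases (ii) and (iii).

   Exponent [Q + 1], [q = Q ^ (2 * s)]: expanding [S * S^*] gives [q] times the
   number of zeros of [a ^+ Q * z ^+ (Q ^ 2) + a * z], i.e. [q] or [q * Q ^ 2].
   Grouping the terms by orbits of the prime subfield shows that [S] is an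
   integer congruent to [1] modulo [Q + 1]. As [Q] is [-1] modulo [Q + 1], this
   forces [S = (- Q) ^ s] or [S = (- Q) ^ (s + 1)].

   Exponent [2]: diagonalising the trace form [Tr (x * y)] over the prime field
   turns [S] into a product of Gauss sums over 'F_p, whose total sign is the
   quadratic character of the discriminant. The discriminant is [delta ^+ 2], where
   [delta] is the determinant of the conjugates of a basis; Frobenius permutes
   the rows of that determinant cyclically, so it multiplies [delta] by
   [(-1) ^ (n - 1)]. The sign of the Gauss sum over 'F_p is Gauss's: his
   alternating sum of q-binomial coefficients, taken at [w ^- 2] with [w] a
   primitive p-th root of unity, expresses the sum as a product of sines. *)

Set Implicit Arguments.
Unset Strict Implicit.
Unset Printing Implicit Defensive.

Import Order.TTheory GRing.Theory Num.Theory.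

Local Open Scope ring_scope.

(** * Gaussian binomials *)

Section GaussianBinomial.

Variables (K : fieldType) (q : K).

(** The q-Pascal recursion, unlike the quotient of q-factorials, divides by nothing and so makes
    sense when [q] is a root of unity. *)
Fixpoint qbin (m j : nat) : K :=
  match m, j with
  | _, 0%N => 1
  | 0%N, _.+1 => 0
  | m'.+1, j'.+1 => qbin m' j' + q ^+ j'.+1 * qbin m' j'.+1
  end.

Lemma qbinn0 m : qbin m 0 = 1. Proof. by case: m. Qed.

Lemma qbinS m j : qbin m.+1 j.+1 = qbin m j + q ^+ j.+1 * qbin m j.+1.
Proof. by []. Qed.

Lemma qbin_small m j : (m < j)%N -> qbin m j = 0.
Proof.
elim: m j => [|m IHm] [|j] //= lt_mj.
by rewrite !IHm ?mulr0 ?addr0 // ltnW.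
Qed.

(** Denominator-free forms of the quotient formula; the second is scaled by [q ^+ j] so that no
    difference of exponents occurs. Within a row the second follows from the first, and Pascal's
    rule then gives the first in the next row from both. *)
Lemma qbin_absorb m :
  (forall j, (1 - q ^+ j.+1) * qbin m.+1 j.+1 = (1 - q ^+ m.+1) * qbin m j) /\
  (forall j,
     (q ^+ j - q ^+ m.+1) * qbin m.+1 j = q ^+ j * (1 - q ^+ m.+1) * qbin m j).
Proof.
have AB m' :
    (forall j, (1 - q ^+ j.+1) * qbin m'.+1 j.+1
                = (1 - q ^+ m'.+1) * qbin m' j) ->
    forall j, (q ^+ j - q ^+ m'.+1) * qbin m'.+1 j
                = q ^+ j * (1 - q ^+ m'.+1) * qbin m' j.
  move=> A [|j]; first by rewrite !qbinn0 expr0; ring.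
  have := A j; rewrite qbinS => Aj.
  have -> : (q ^+ j.+1 - q ^+ m'.+1) * (qbin m' j + q ^+ j.+1 * qbin m' j.+1)
     = (1 - q ^+ m'.+1) * (qbin m' j + q ^+ j.+1 * qbin m' j.+1)
       - (1 - q ^+ j.+1) * (qbin m' j + q ^+ j.+1 * qbin m' j.+1) by ring.
  by rewrite Aj; ring.
suff A : forall j, (1 - q ^+ j.+1) * qbin m.+1 j.+1 = (1 - q ^+ m.+1) * qbin m j.
  by split=> //; apply: AB.
elim: m => [|m A] j; first by case: j => [|j] /=; ring.
have Bj := AB m A j.
rewrite qbinS.
transitivity ((1 - q ^+ j.+1) * qbin m.+1 j
    + q * q ^+ j * ((1 - q ^+ j.+1) * qbin m.+1 j.+1)); first by rewrite exprS; ring.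
rewrite A -!mulrA [q ^+ j * _]mulrA -Bj !exprS.
by ring.
Qed.

Arguments qbin : simpl never.

(** Gauss's recursion. Pascal's rule splits row [m.+2]; after an index shift the terms pair up with
    factors [1 - q ^+ i.+1], which absorption trades for the constant [1 - q ^+ m.+1]. *)
Lemma qbin_alt_sumSS m :
  \sum_(j < m.+3) (-1) ^+ j * qbin m.+2 j
  = (1 - q ^+ m.+1) * \sum_(j < m.+1) (-1) ^+ j * qbin m j.
Proof.
rewrite big_ord_recl qbinn0 expr0 mulr1.
have -> : \sum_(i < m.+2) (-1) ^+ lift ord0 i * qbin m.+2 (lift ord0 i)
   = - (\sum_(i < m.+2) (-1) ^+ i * qbin m.+1 i)
     - \sum_(i < m.+2) (-1) ^+ i * (q ^+ i.+1 * qbin m.+1 i.+1).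
  rewrite -opprD -big_split /= -sumrN; apply: eq_bigr => i _.
  by rewrite /bump leq0n add1n qbinS [(-1) ^+ i.+1]exprS; ring.
rewrite big_ord_recl qbinn0 expr0 mulr1 [X in _ - X]big_ord_recr /=.
rewrite [qbin _ m.+2]qbin_small // !(mulr0, addr0).
rewrite opprD !addrA subrr add0r -opprD -big_split /= -sumrN mulr_sumr.
apply: eq_bigr => i _; rewrite [RHS]mulrCA -(qbin_absorb m).1.
rewrite /bump leq0n add1n [(-1) ^+ i.+1]exprS.
by ring.
Qed.

Lemma qbin_alt_sum_double k :
  \sum_(j < k.*2.+1) (-1) ^+ j * qbin k.*2 j = \prod_(i < k) (1 - q ^+ i.*2.+1).
Proof.
elim: k => [|k IHk]; first by rewrite big_ord_recr !big_ord0 /= mulr1 add0r.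
by rewrite doubleS qbin_alt_sumSS IHk big_ord_recr /= mulrC.
Qed.

(** In the quotient formula for row [p - 1], [q ^ p = 1] turns each factor [1 - q ^ (p - i)] into
    [- q ^ (- i) * (1 - q ^ i)], so only signs and a power of [q] survive. *)
Lemma qbin_prim_root p j : p.-primitive_root q -> (j < p)%N ->
  q ^+ 'C(j.+1, 2) * qbin p.-1 j = (-1) ^+ j.
Proof.
move=> pr; elim: j => [|j IHj] lt_jp; first by rewrite qbinn0 !mulr1.
case: p pr lt_jp IHj => [|[|m]] // pr lt_jp IHj.
have q_j : 1 - q ^+ j.+1 != 0.
  rewrite subr_eq0 eq_sym -(prim_order_dvd pr); apply/negP => /dvdn_leq.
  by move=> /(_ isT); rewrite leqNgt lt_jp.
have [A B] := qbin_absorb m.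
have step : q ^+ j.+1 * qbin m.+1 j.+1 = - qbin m.+1 j.
  apply: (mulfI q_j); rewrite mulrCA A.
  have := B j; move/(congr1 (fun z => q * z)).
  rewrite mulrA mulrBr -!exprS (prim_expr_order pr) -mulrA mulrA -exprS => <-.
  by ring.
have {IHj} := IHj (ltnW lt_jp); rewrite [X in _ = _ -> q ^+ X * _ = _]binS bin1.
move: 'C(j.+1, 2) => b IHj.
by rewrite exprD -mulrA [q ^+ j.+1 * _]step mulrN IHj exprS mulN1r.
Qed.

End GaussianBinomial.

Lemma sum_ord_shift (V : zmodType) (p k : nat) (F : nat -> V) :
  (forall j, F (j + p)%N = F j) -> \sum_(j < p) F (j + k)%N = \sum_(j < p) F j.
Proof.
move=> Fp; elim: k F Fp => [|k IHk] F Fp; first by apply: eq_bigr => j _; rewrite addn0.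
under eq_bigr do rewrite addnS -addSn.
rewrite (IHk (F \o S)) => [|j]; last by rewrite /= -addSn Fp.
case: p Fp {IHk} => [|p] Fp; first by rewrite !big_ord0.
by rewrite big_ord_recr big_ord_recl /= -[p.+1]add0n Fp addrC.
Qed.

Lemma quad_sum_prod (K : fieldType) (p : nat) (w : K) :
  odd p -> p.-primitive_root w ->
  \sum_(j < p) w ^+ (j ^ 2) = \prod_(i < p./2) (w ^+ i.*2.+1 - w ^- i.*2.+1).
Proof.
move=> p_odd pr; set h := p./2.
have ph : p = h.*2.+1 by rewrite -[LHS]odd_double_half p_odd.
have w0 : w != 0 by rewrite (prim_root_eq0 pr) ph.
have wV k : w ^- k = w ^+ (p.-1 * k).
  rewrite -exprVn exprM; congr (_ ^+ k); apply: (mulfI w0).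
  by rewrite -exprS divff // ph -pred_Sn -ph (prim_expr_order pr).
have pr2 : p.-primitive_root (w ^- 2).
  by rewrite wV (prim_root_exp_coprime _ pr) coprimeMl coprime2n p_odd
     coprimePn // ph.
have E := qbin_alt_sum_double (w ^- 2) h.
have sumE : \sum_(j < h.*2.+1) (-1) ^+ j * qbin (w ^- 2) h.*2 j
    = \sum_(j < p) w ^+ (j * j.+1).
  rewrite [in RHS]ph; apply: eq_bigr => j _.
  have := qbin_prim_root (j := j) pr2; rewrite {1}ph ltn_ord => /(_ isT).
  have -> : p.-1 = h.*2 by rewrite ph.
  have w2 : w ^- 2 ^+ 'C(j.+1, 2) * w ^+ (j * j.+1) = 1.
    have -> : (j * j.+1 = 2 * 'C(j.+1, 2))%N.
      by rewrite bin2 /= mul2n halfK oddM /= andNb subn0 mulnC.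
    by rewrite [in X in _ * X]exprM -exprMn mulVf ?expr1n // expf_neq0.
  move=> Ej; apply: (mulfI (expf_neq0 'C(j.+1, 2) (invr_neq0 (expf_neq0 2 w0)))).
  by rewrite mulrCA Ej -expr2 sqrr_sign w2.
(* The first [h] odd numbers add up to [h ^ 2]; this spreads the prefactor of the next step over the
   product. *)
have P1 : \prod_(i < h) w ^+ i.*2.+1 = w ^+ (h ^ 2).
  elim: (h) => [|k IHk]; first by rewrite big_ord0 expr0.
  by rewrite big_ord_recr /= IHk -exprD; congr (_ ^+ _); lia.
(* Completing the square: [2 * (h + 1) = p + 1], so [h ^ 2 + j * (j + 1)] is [(j + h + 1) ^ 2]
   modulo [p], and the shift by [h + 1] permutes the residues. *)
transitivity (w ^+ (h ^ 2) * \prod_(i < h) (1 - w ^- 2 ^+ i.*2.+1)).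
  rewrite -E sumE mulr_sumr.
  rewrite -(@sum_ord_shift _ p h.+1 (fun j => w ^+ (j ^ 2))) => [|j]; last first.
    apply/eqP; rewrite (eq_prim_root_expr pr).
    have -> : ((j + p) ^ 2 = j ^ 2 + (2 * j + p) * p)%N by lia.
    by rewrite addnC modnMDl.
  apply: eq_bigr => j _; rewrite -exprD; apply/eqP; rewrite (eq_prim_root_expr pr).
  have -> : ((j + h.+1) ^ 2 = (j + 1) * p + (h ^ 2 + j * j.+1))%N.
    by move: (nat_of_ord j) => k; rewrite ph -!mulnn -!muln2; lia.
  by rewrite modnMDl.
rewrite -P1 -big_split /=; apply: eq_bigr => i _.
rewrite mulrBr mulr1; congr (_ - _).
rewrite -exprVn -exprM mulnC exprM expr2 exprVn mulrA divff ?mul1r //.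
by rewrite expf_neq0.
Qed.

(** * Powers in finite fields *)

Section FiniteFieldPowers.

Variable F : finFieldType.
Let N := #|F|.-1.

Lemma finField_pred_gt0 : (0 < N)%N.
Proof. by rewrite /N -subn1 subn_gt0 finNzRing_gt1. Qed.

Lemma finField_expf_pred (x : F) : x != 0 -> x ^+ N = 1.
Proof.
move=> x0; apply: (mulfI x0); rewrite -exprS /N prednK ?expf_card ?mulr1 //.
exact: ltnW (finNzRing_gt1 F).
Qed.

Lemma expf_pred_eq1 (x : F) : (x ^+ N == 1) = (x != 0).
Proof.
have [->|x0] := eqVneq x 0; last by rewrite finField_expf_pred ?eqxx.
by rewrite expr0n gtn_eqF ?finField_pred_gt0 // eq_sym oner_eq0.
Qed.

Lemma finField_prim_root : exists g : F, N.-primitive_root g.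
Proof.
pose rs := enum [pred x : F | x != 0].
have : has N.-primitive_root rs.
  apply: has_prim_root; rewrite ?enum_uniq ?finField_pred_gt0 //.
    by apply/allP => x; rewrite mem_enum inE unity_rootE expf_pred_eq1.
  by rewrite -cardE /N (cardD1 (0 : F)) inE /=; apply/subset_leq_card/subsetP => x;
     rewrite !inE andbT.
by case/hasP => g _ ?; exists g.
Qed.

Lemma prim_root_exists k : (k %| N)%N -> exists w : F, k.-primitive_root w.
Proof.
have [g pg] := finField_prim_root; move=> kN; exists (g ^+ (N %/ k)).
exact: dvdn_prim_root.
Qed.

Lemma sum_unity_root (V : nmodType) k (w : F) (f : F -> V) :
  k.-primitive_root w -> \sum_(x : F | x ^+ k == 1) f x = \sum_(j < k) f (w ^+ j).
Proof.
move=> pw; pose h (j : 'I_k) := w ^+ j.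
have injh : injective h.
  move=> i j /eqP; rewrite /h (eq_prim_root_expr pw) !modn_small //.
  by move/eqP/val_inj.
rewrite -(big_imset f (h := h) (A := 'I_k)) => [|i j _ _]; last exact: injh.
apply: eq_bigl => x; apply/eqP/imsetP => [/(prim_rootP pw)[i ->]|[i _ ->]].
  by exists i.
by rewrite /h exprAC (prim_expr_order pw) expr1n.
Qed.

Lemma card_unity_root k : (k %| N)%N -> #|[set x : F | x ^+ k == 1]| = k.
Proof.
case/prim_root_exists => w pw; rewrite -sum1_card.
rewrite (eq_bigl (fun x => x ^+ k == 1)) => [|x]; last by rewrite inE.
by rewrite (sum_unity_root (fun=> 1%N) pw) sum1_card card_ord.
Qed.

(** For [x = g ^ j] with [g] a generator, both sides say that [k] divides [j]. *)
Lemma is_powerP k (x : F) : (k %| N)%N -> x != 0 ->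
  reflect (exists z, z ^+ k = x) (x ^+ (N %/ k) == 1).
Proof.
move=> kN x0; have k_gt0 : (0 < k)%N by apply: dvdn_gt0 kN; apply: finField_pred_gt0.
apply: (iffP eqP) => [|[z zx]].
  have [g pg] := finField_prim_root.
  have [j ->] := prim_rootP pg (finField_expf_pred x0).
  rewrite -exprM => /eqP; rewrite -(prim_order_dvd pg).
  have Nk0 : (0 < N %/ k)%N by rewrite divn_gt0 // dvdn_leq // finField_pred_gt0.
  have -> : (N %| j * (N %/ k))%N = (k %| j)%N.
    by rewrite -[RHS](dvdn_pmul2r Nk0) [(k * _)%N]mulnC divnK.
  by case/dvdnP => i ->; exists (g ^+ i); rewrite -exprM.
rewrite -zx -exprM mulnC divnK // finField_expf_pred //.
by apply: contra_neq x0 => z0; rewrite -zx z0 expr0n gtn_eqF.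
Qed.

(** By Bezout, the powers of exponents [k] and [d = gcdn k N] have the same image and the same
    kernel on the nonzero elements, hence fibres of the same size; both sums are then grouped by
    fibres. *)
Lemma sum_expr_gcd (V : nmodType) (k l : nat) (f : F -> V) :
  (0 < k)%N -> (0 < l)%N -> gcdn k N = gcdn l N ->
  \sum_x f (x ^+ k) = \sum_x f (x ^+ l).
Proof.
suff H k' : (0 < k')%N -> \sum_x f (x ^+ k') = \sum_x f (x ^+ gcdn k' N).
  by move=> k0 l0 e; rewrite H // e -H.
move=> {k l} k_gt0; set k := k' in k_gt0 *; set d := gcdn k N.
have d_gt0 : (0 < d)%N by rewrite gcdn_gt0 k_gt0.
have [u v uv _] := egcdnP N k_gt0.
rewrite -/d in uv.
have dk : (d %| k)%N by exact: dvdn_gcdl.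
have powd (x : F) : x != 0 -> (x ^+ u) ^+ k = x ^+ d.
  move=> x0; rewrite -exprM uv addnC exprD mulnC exprM.
  by rewrite finField_expf_pred // expr1n mulr1.
have powk (x : F) : (x ^+ (k %/ d)) ^+ d = x ^+ k by rewrite -exprM divnK.
have ker (x : F) : x != 0 -> (x ^+ k == 1) = (x ^+ d == 1).
  move=> x0; apply/eqP/eqP => [xk|xd]; last by rewrite -(divnK dk) mulnC exprM xd expr1n.
  by rewrite -powd // exprAC xk expr1n.
pose c e y := #|[set x : F | x ^+ e == y]|.
have fib e : \sum_x f (x ^+ e) = \sum_y f y *+ c e y.
  rewrite (partition_big (fun x => x ^+ e) xpredT) //=; apply: eq_bigr => y _.
  rewrite (eq_bigr (fun=> f y)) => [|x /eqP -> //].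
  by rewrite sumr_const /c; congr (_ *+ _); apply: eq_card => x; rewrite inE.
rewrite !fib; apply: eq_bigr => y _; congr (_ *+ _).
have [->|y0] := eqVneq y 0.
  by apply: eq_card => x; rewrite !inE !expf_eq0 k_gt0 d_gt0.
have coset e (x : F) : (0 < e)%N -> x ^+ e = y ->
    c e y = #|[set z : F | (z != 0) && (z ^+ e == 1)]|.
  move=> e0 xy; have x0 : x != 0.
    by apply: contra_neq y0 => x0; rewrite -xy x0 expr0n gtn_eqF.
  rewrite /c -[RHS](card_imset _ (mulfI x0)); apply: eq_card => t.
  rewrite inE; apply/eqP/imsetP => [ty|[z]].
    exists (x^-1 * t); last by rewrite mulrA divff ?mul1r.
    rewrite inE exprMn exprVn ty xy mulVf // eqxx andbT mulf_neq0 ?invr_neq0 //.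
    by apply: contra_neq y0 => t0; rewrite -ty t0 expr0n gtn_eqF.
  by rewrite inE => /andP[_ /eqP z1] ->; rewrite exprMn z1 mulr1.
have [/existsP[x /eqP xy]|nex] := boolP [exists x : F, x ^+ k == y].
  rewrite (coset k x) // (coset d (x ^+ (k %/ d))) ?powk //.
  by apply: eq_card => z; rewrite !inE; case: eqP => //= /eqP z0; rewrite ker.
have nil e : ~~ [exists x : F, x ^+ e == y] -> c e y = 0%N.
  move=> /existsPn ne; apply/eqP; rewrite cards_eq0; apply/eqP/setP => x.
  by rewrite !inE (negbTE (ne x)).
rewrite !nil //; apply: contra nex => /existsP[x /eqP xy].
apply/existsP; exists (x ^+ u); rewrite powd ?xy //.
by apply: contra_neq y0 => x0; rewrite -xy x0 expr0n gtn_eqF.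
Qed.

End FiniteFieldPowers.

(** * Additive characters *)

Section FrobeniusPowers.

Variables (F : finFieldType) (p : nat).
Hypothesis chF : p \in [pchar F].

Lemma exprD_pcharX m (x y : F) : (x + y) ^+ (p ^ m) = x ^+ (p ^ m) + y ^+ (p ^ m).
Proof.
apply: exprDn_pchar; rewrite pnatX; apply/orP; left.
by rewrite pnatE ?(pcharf_prime chF).
Qed.

Lemma exprN_pcharX m (x : F) : (- x) ^+ (p ^ m) = - x ^+ (p ^ m).
Proof.
apply/eqP; rewrite -addr_eq0 -exprD_pcharX addNr expr0n expn_eq0.
by rewrite -leqn0 leqNgt (prime_gt0 (pcharf_prime chF)).
Qed.

Lemma expr_pcharX_inj m : injective (fun x : F => x ^+ (p ^ m)).
Proof.
move=> x y /eqP; rewrite -subr_eq0 -exprN_pcharX -exprD_pcharX.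
by rewrite expf_eq0 => /andP[_]; rewrite subr_eq0 => /eqP.
Qed.

Lemma pchar_odd_two_neq0 : odd p -> (2%:R : F) != 0.
Proof.
move=> p_odd; rewrite -(dvdn_pcharf chF); apply/negP => /dvdn_leq => /(_ isT).
by have := prime_gt1 (pcharf_prime chF); case: (p) p_odd => [|[|[|]]].
Qed.

End FrobeniusPowers.

Section AdditiveCharacters.

Variables (F : finFieldType) (C : numClosedFieldType) (psi : F -> C).

(** A nontrivial additive character; [addchar_conj] encodes that its values have modulus one. *)
Record add_character : Prop := AddCharacter {
  addchar0 : psi 0 = 1;
  addcharD : forall x y, psi (x + y) = psi x * psi y;
  addchar_conj : forall x, (psi x)^* = psi (- x);
  addchar_nontriv : exists x, psi x != 1 }.

Hypothesis psiC : add_character.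

Lemma addchar_sum z : \sum_y psi (z * y) = if z == 0 then #|F|%:R else 0.
Proof.
case: eqP => [->|/eqP z0].
  rewrite (eq_bigr (fun=> 1)) => [|y _]; last by rewrite mul0r addchar0.
  by rewrite sumr_const.
have [x0 psix0] := addchar_nontriv psiC.
rewrite -(reindex_inj (mulfI z0) (P := xpredT) (F := psi)) /=.
have E : \sum_y psi y = psi x0 * \sum_y psi y.
  rewrite mulr_sumr (reindex_inj (addrI x0)); apply: eq_bigr => y _ /=.
  exact: addcharD.
have : (1 - psi x0) * \sum_y psi y = 0 by rewrite mulrBl mul1r -E subrr.
by move/eqP; rewrite mulf_eq0 subr_eq0 eq_sym (negbTE psix0) => /eqP.
Qed.

Section HermitianSum.

Variables (p m : nat) (a : F).
Hypothesis chF : p \in [pchar F].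
Hypothesis p_odd : odd p.
Hypothesis psiF : forall x, psi (x ^+ p) = psi x.
Let Q := (p ^ m)%N.

(** The radical of the pairing [psi (a * z ^+ Q * y + a * z * y ^+ Q)]: applying the [Q]-Frobenius
    to the first term makes both terms multiples of [y ^+ Q], with this coefficient. *)
Definition herm_kernel := [set z : F | a ^+ Q * z ^+ (Q ^ 2) + a * z == 0].

Lemma addchar_expX x : psi (x ^+ Q) = psi x.
Proof.
by rewrite /Q; elim: m => [|k IHk]; rewrite ?expr1 // expnSr exprM psiF.
Qed.

(** With [u = 2 * v], Frobenius invariance gives [psi v = psi (- v)], so
    [psi u = psi (- v) * psi v = 1]. On [herm_kernel] it applies to [u = a * z ^+ Q.+1]. *)
Lemma addchar_opp_fix u : u ^+ Q = - u -> psi u = 1.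
Proof.
move=> uQ; pose v := u / 2%:R.
have uv : u = v + v.
  by rewrite -mulr2n -mulr_natr mulfVK // (pchar_odd_two_neq0 chF).
have vQ : v ^+ Q = - v.
  apply: (mulIf (pchar_odd_two_neq0 chF p_odd)).
  rewrite mulNr divfK ?(pchar_odd_two_neq0 chF) // -uQ [in RHS]uv.
  by rewrite (exprD_pcharX chF) mulr_natr mulr2n.
rewrite uv addcharD // -{1}addchar_expX vQ -addcharD //.
by rewrite addNr addchar0.
Qed.

(* Substituting x = y + z turns the inner sum over y into an additive character
   sum, which vanishes unless z lies in the kernel of the associated Hermitian
   form. *)
Lemma sqr_norm_herm_sum :
  let S := \sum_x psi (a * x ^+ Q.+1) in
  S * S^* = #|F|%:R * #|herm_kernel|%:R.
Proof.
move=> S; rewrite {2}/S rmorph_sum mulr_sumr.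
under eq_bigr => y _.
  rewrite mulr_suml (reindex_inj (addIr y)) /=.
  under eq_bigr => z _.
    rewrite addchar_conj // -addcharD // [X in psi X](_ : _ =
      a * z ^+ Q.+1 + (a * z ^+ Q * y + a * z * y ^+ Q)); last first.
      by rewrite !exprS (exprD_pcharX chF); ring.
    rewrite !addcharD // -[psi (a * z ^+ Q * y)]addchar_expX -addcharD //.
    rewrite !exprMn -exprM mulnn -mulrDl.
    over.
  over.
rewrite exchange_big /= [RHS]mulrC mulr_natl -sumr_const.
rewrite [RHS](eq_bigl (fun z => a ^+ Q * z ^+ (Q ^ 2) + a * z == 0)); last first.
  by move=> z; rewrite inE.
rewrite [RHS]big_mkcond; apply: eq_bigr => z _.
rewrite -mulr_sumr.
rewrite -(reindex_inj (@expr_pcharX_inj _ _ chF m) (P := xpredT)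
  (F := fun y => psi ((a ^+ Q * z ^+ (Q ^ 2) + a * z) * y))) /=.
rewrite addchar_sum; case: eqP => [z0|]; last by rewrite mulr0.
rewrite addchar_opp_fix ?mul1r // exprMn -exprM mulSn exprD mulnn.
rewrite mulrCA (_ : a ^+ Q * _ = - (a * z)) ?mulrN; last first.
  by apply/eqP; rewrite -addr_eq0 z0.
by rewrite exprS; ring.
Qed.

End HermitianSum.

End AdditiveCharacters.

(** * Even degree *)

Lemma sum_ord_mul (V : nmodType) (n k : nat) (f : nat -> V) :
  \sum_(j < n * k) f j = \sum_(t < n) \sum_(i < k) f (i + t * k)%N.
Proof.
rewrite -(big_mkord xpredT f) big_nat_mul big_mkord; apply: eq_bigr => t _.
by rewrite -{1}[(t * k)%N]add0n big_addn mulSn addnK big_mkord.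
Qed.

(** The quotient is a geometric sum of [s] odd terms. *)
Lemma odd_geometric (b s : nat) : odd b -> (1 < b)%N ->
  odd ((b ^ s).-1 %/ b.-1) = odd s.
Proof.
move=> b_odd b_gt1; rewrite predn_exp mulKn; last by case: (b) b_gt1 => [|[]].
elim: s => [|s IHs]; first by rewrite big_ord0.
by rewrite big_ord_recr oddD IHs oddX b_odd orbT addbT.
Qed.

(** The square fixes [z] up to sign. As [- Q] is [1] modulo [Q + 1], the wrong sign would make
    [Q + 1 > 2] divide [2]. *)
Lemma int_sqr_congr (Q k : nat) (z j : int) : (1 < Q)%N ->
  z ^+ 2 = (Q ^ k)%:Z ^+ 2 -> z = 1 + Q.+1%:Z * j -> z = (- Q%:Z) ^+ k.
Proof.
move=> Q_gt1 z2 zj.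
have : z ^+ 2 = ((- Q%:Z) ^+ k) ^+ 2.
  by rewrite z2 -!natz natrX -!exprM mulnC !exprM sqrrN.
move/eqP; rewrite eqf_sqr => /orP[/eqP //|/eqP zN].
have [i Qi] : exists i : int, (- Q%:Z) ^+ k = 1 + Q.+1%:Z * i.
  elim: (k) => [|k' [i IH]]; first by exists 0; rewrite expr0 mulr0 addr0.
  exists (-1 - Q%:Z * i); rewrite exprS IH -addn1 PoszD; ring.
have : (Q.+1%:Z %| 2)%Z.
  apply/dvdzP; exists (- i - j).
  have : z = z by []. rewrite {1}zN Qi zj => E; lia.
by rewrite dvdzE /= => /dvdn_leq; lia.
Qed.

Section EvenDegree.

Variables (F : finFieldType) (C : numClosedFieldType) (psi : F -> C).
Variable p : nat.
Hypothesis psiC : add_character psi.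
Hypothesis chF : p \in [pchar F].
Hypothesis p_odd : odd p.
Let N := #|F|.-1.

Let p_gt1 : (1 < p)%N. Proof. exact: prime_gt1 (pcharf_prime chF). Qed.

(** With [c = 0] added, this is the sum of a character of the prime subfield, so it is either the
    number of elements or [0]. *)
Lemma addchar_sum_prime_subfield y :
  exists j : int, \sum_(c | c ^+ p.-1 == 1) psi (y * c) = j%:~R.
Proof.
have addB (c d : F) : (c + d) ^+ p = c ^+ p + d ^+ p.
  by have := exprD_pcharX chF 1 c d; rewrite expn1.
have split : \sum_(c | c ^+ p == c) psi (y * c)
    = 1 + \sum_(c | c ^+ p.-1 == 1) psi (y * c).
  rewrite (bigD1 0) /=; last by rewrite expr0n gtn_eqF // ltnW.
  rewrite mulr0 addchar0 //; congr (_ + _); apply: eq_bigl => c.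
  have [->|c0] := eqVneq c 0.
    by rewrite andbF expr0n -subn1 subn_eq0 leqNgt p_gt1 /= eq_sym oner_eq0.
  rewrite andbT; have -> : (c ^+ p == c) = (c * c ^+ p.-1 == c * 1).
    by rewrite -exprS mulr1 prednK // ltnW.
  by rewrite (inj_eq (mulfI c0)).
have [/forall_inP all1|] := boolP [forall (c | c ^+ p == c), psi (y * c) == 1].
  exists (#|[pred c : F | c ^+ p == c]|%:Z - 1); apply: (addrI 1); rewrite -split.
  rewrite (eq_bigr (fun=> 1)) => [|c /all1 /eqP //].
  by rewrite sumr_const intrD addrCA subrr addr0.
rewrite negb_forall => /existsP[b]; rewrite negb_imply => /andP[/eqP bp b1].
exists (-1); apply: (addrI 1); rewrite -split subrr.
have E : \sum_(c | c ^+ p == c) psi (y * c)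
    = psi (y * b) * \sum_(c | c ^+ p == c) psi (y * c).
  rewrite mulr_sumr (reindex_inj (addrI b)); apply: eq_big => [c|c _].
    by rewrite addB bp (inj_eq (addrI b)).
  by rewrite mulrDr addcharD.
have : (1 - psi (y * b)) * \sum_(c | c ^+ p == c) psi (y * c) = 0.
  by rewrite mulrBl mul1r -E subrr.
by move/eqP; rewrite mulf_eq0 subr_eq0 eq_sym (negbTE b1) => /eqP.
Qed.

(** Write a nonzero [x] as [g ^ (i + (t + u * (p - 1)) * L)] with [N = r * (p - 1) * L]. Then
    [x ^ r = g ^ (i * r) * w ^ t], where [w] generates the nonzero prime subfield: the [r] values of
    [u] give equal terms, and summing over [t] gives an integer. *)
Lemma addchar_sum_pow_int r a : (r * p.-1 %| N)%N -> 
  exists j : int, \sum_x psi (a * x ^+ r) = (1 + r%:Z * j)%:~R.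
Proof.
move=> rN; have N_gt0 : (0 < N)%N by exact: finField_pred_gt0.
have [r_gt0 p1_gt0] : (0 < r)%N /\ (0 < p.-1)%N.
  by apply/andP; rewrite -muln_gt0; apply: dvdn_gt0 rN.
have [g pg] := finField_prim_root F.
pose L := (N %/ (r * p.-1))%N.
have NL : N = (r * p.-1 * L)%N by rewrite mulnC divnK.
have pw : (p.-1).-primitive_root (g ^+ (r * L)).
  rewrite (_ : r * L = N %/ p.-1)%N; last by rewrite NL mulnAC mulnK.
  by apply: (dvdn_prim_root pg); apply: dvdn_trans rN; apply: dvdn_mull.
set w := g ^+ _ in pw.
pose P (z : C) := exists j : int, z = j%:~R.
have [j Ej] : P (\sum_(i < L) \sum_(c | c ^+ p.-1 == 1) psi (a * g ^+ (i * r) * c)).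
  apply: (big_ind P) => [|x y [j ->] [k ->]|i _]; first by exists 0.
    by exists (j + k); rewrite intrD.
  exact: addchar_sum_prime_subfield.
exists j; rewrite (bigD1 0) //= expr0n gtn_eqF // mulr0 addchar0 // intrD intrM -Ej.
congr (_ + _).
transitivity (\sum_(x : F | x ^+ N == 1) psi (a * x ^+ r)).
  by apply: eq_bigl => x; rewrite expf_pred_eq1.
rewrite (sum_unity_root (fun x => psi (a * x ^+ r)) pg) -/N NL.
rewrite (sum_ord_mul _ _ (fun j => psi (a * (g ^+ j) ^+ r))).
rewrite exchange_big mulr_sumr; apply: eq_bigr => i _.
rewrite (sum_unity_root (fun c => psi (a * g ^+ (i * r) * c)) pw).
rewrite (sum_ord_mul _ _ (fun t => psi (a * (g ^+ (i + t * L)) ^+ r))).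
rewrite mulr_natl -[X in _ *+ X](card_ord r) -sumr_const.
apply: eq_bigr => u _.
apply: eq_bigr => t _; congr psi; rewrite -mulrA; congr (_ * _).
rewrite -exprM mulnDl exprD; congr (_ * _).
rewrite (_ : (t + u * p.-1) * L * r = (r * L) * t + (r * L * p.-1) * u)%N; last by ring.
rewrite exprD [g ^+ (_ * t)]exprM [g ^+ (_ * u)]exprM [g ^+ (_ * p.-1)]exprM -/w.
by rewrite (prim_expr_order pw) expr1n mulr1.
Qed.

Hypothesis psiF : forall x, psi (x ^+ p) = psi x.
Variables (m s : nat) (a : F).
Hypothesis m_gt0 : (0 < m)%N.
Hypothesis a_neq0 : a != 0.
Let Q := (p ^ m)%N.
Hypothesis cardF : #|F| = ((Q ^ 2) ^ s)%N.
Let k := (N %/ (Q ^ 2).-1)%N.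

Let Q_gt1 : (1 < Q)%N.
Proof. by rewrite -{1}(expn0 p) ltn_exp2l. Qed.

Let Q2_gt1 : (1 < Q ^ 2)%N.
Proof. by rewrite (leq_trans Q_gt1) // expnS expn1 leq_pmull // ltnW. Qed.

Let dvdN : ((Q ^ 2).-1 %| N)%N.
Proof. by rewrite /N cardF [X in (_ %| X)%N]predn_exp dvdn_mulr. Qed.

(** A nonzero [z] lies in the kernel when [z ^ (Q ^ 2 - 1) = c] with [c = - a ^ (1 - Q)]. This has
    [Q ^ 2 - 1] roots or none, according to whether [c ^ k = 1], and [k] has the parity of [s]. *)
Lemma card_herm_kernel :
  #|herm_kernel p m a| = if a ^+ (Q.-1 * k) == (-1) ^+ s then (Q ^ 2)%N else 1%N.
Proof.
have Q2_gt0 : (0 < Q ^ 2)%N := ltnW Q2_gt1.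
have aQ0 : a ^+ Q.-1 != 0 by rewrite expf_neq0.
pose c := - (a ^+ Q.-1)^-1.
have kerE z : z != 0 -> (z \in herm_kernel p m a) = (z ^+ (Q ^ 2).-1 == c).
  move=> z0; rewrite inE -/Q.
  have -> : a ^+ Q * z ^+ (Q ^ 2) + a * z
      = (a * z) * (a ^+ Q.-1 * z ^+ (Q ^ 2).-1 + 1).
    have -> : a ^+ Q = a * a ^+ Q.-1 by rewrite -exprS prednK // ltnW.
    have -> : z ^+ (Q ^ 2) = z * z ^+ (Q ^ 2).-1 by rewrite -exprS prednK.
    by ring.
  rewrite mulf_eq0 (negbTE (mulf_neq0 a_neq0 z0)) /= -(inj_eq (mulfI aQ0) _ c).
  by rewrite /c mulrN divff // addr_eq0.
have c0 : c != 0 by rewrite oppr_eq0 invr_eq0.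
have solv : (c ^+ k == 1) = (a ^+ (Q.-1 * k) == (-1) ^+ s).
  rewrite exprM /c [X in X == 1]exprNn exprVn.
  have -> : (-1) ^+ k = (-1) ^+ s :> F.
    rewrite -signr_odd -[RHS]signr_odd; congr (_ ^+ _).
    by rewrite /k /N cardF odd_geometric ?oddX ?p_odd ?orbT.
  have Ak0 := expf_neq0 k aQ0.
  apply/eqP/eqP => [h|->]; last by rewrite mulfV ?signr_eq0.
  by move/(congr1 (fun z => z * a ^+ Q.-1 ^+ k)): h; rewrite divfK // mul1r => ->.
have ker0 : 0 \in herm_kernel p m a.
  by rewrite inE -/Q expr0n gtn_eqF // !mulr0 addr0.
rewrite -solv; case: (is_powerP dvdN c0) => [[z0 z0c]|nex].
  have z00 : z0 != 0.
    apply: contra_neq c0 => z00; rewrite -z0c z00 expr0n gtn_eqF //.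
    by rewrite -subn1 subn_gt0.
  rewrite (cardsD1 0) ker0 -[RHS](prednK Q2_gt0) add1n; congr _.+1.
  rewrite -[RHS](card_unity_root dvdN) -[RHS](card_imset _ (mulfI z00)).
  apply: eq_card => z; rewrite !inE; apply/andP/imsetP => [[z0' zK]|[u]].
    exists (z0^-1 * z); last by rewrite mulrA divff ?mul1r.
    rewrite inE exprMn exprVn z0c.
    by have := kerE z z0'; rewrite inE zK => /esym /eqP ->; rewrite mulVf.
  rewrite inE => u1 ->.
  have u0 : u != 0.
    apply: contraTneq u1 => ->.
    by rewrite expr0n gtn_eqF -?subn1 ?subn_gt0 // eq_sym oner_eq0.
  have zu0 := mulf_neq0 z00 u0; split=> //.
  by have := kerE _ zu0; rewrite [X in _ = (X == _)]exprMn (eqP u1) mulr1 z0c eqxx inE.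
apply/eqP/cards1P; exists 0; apply/setP => z; rewrite [RHS]inE.
have [->|z0] := eqVneq z 0; first by rewrite ker0.
rewrite kerE //; apply/eqP => zc; apply: nex; by exists z.
Qed.

(** The sum is an integer, so [sqr_norm_herm_sum] gives its square, [Q ^ (2 * s)] or
    [Q ^ (2 * s + 2)]; the congruence modulo [Q + 1] gives the sign. The boolean in the exponent
    counts as [0] or [1]. *)
Lemma herm_sum_even_degree :
  \sum_x psi (a * x ^+ Q.+1)
  = (- Q%:R) ^+ (s + (a ^+ (Q.-1 * k) == (-1) ^+ s)).
Proof.
have dv : (Q.+1 * p.-1 %| N)%N.
  apply: dvdn_trans dvdN.
  have -> : (Q ^ 2).-1 = (Q.+1 * Q.-1)%N.
    by rewrite -mulnn; case: (Q) Q_gt1 => // Q' _; lia.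
  by rewrite dvdn_pmul2l // /Q [X in (_ %| X)%N]predn_exp dvdn_mulr.
have [j Sj] := addchar_sum_pow_int a dv.
have := sqr_norm_herm_sum psiC m a chF p_odd psiF.
rewrite /= -/Q card_herm_kernel Sj rmorph_int cardF => E.
rewrite (@int_sqr_congr Q (s + (a ^+ (Q.-1 * k) == (-1) ^+ s)) (1 + Q.+1%:Z * j) j) //.
  by rewrite rmorphXn /= rmorphN.
apply: (mulrIz (oner_neq0 C)).
rewrite expr2 intrM E rmorphXn /= -pmulrn -natrX -natrM; congr (_%:R).
by case: (_ == _); rewrite -!expnM ?muln1 -?expnD; congr (_ ^ _)%N; lia.
Qed.

End EvenDegree.

(** * The trace form *)

Section PrimeSubfield.

Variables (F : fieldType) (p : nat).
Hypothesis chF : p \in [pchar F].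

(** The shape is that of [abs_traceE]; characteristic [p] makes this cast of representatives a ring
    embedding. *)
Definition Fp_embed (c : 'F_p) : F := (c : nat)%:R.

Let p_pr := pcharf_prime chF.

Lemma natr_mod_pchar m : (m %% p)%:R = m%:R :> F.
Proof. by rewrite [in RHS](divn_eq m p) natrD natrM (pcharf0 chF) mulr0 add0r. Qed.

Lemma Fp_embedD c d : Fp_embed (c + d) = Fp_embed c + Fp_embed d.
Proof. by rewrite /Fp_embed /= [X in (_ %% X)%N]Fp_cast // natr_mod_pchar natrD. Qed.

Lemma Fp_embedM c d : Fp_embed (c * d) = Fp_embed c * Fp_embed d.
Proof. by rewrite /Fp_embed /= [X in (_ %% X)%N]Fp_cast // natr_mod_pchar natrM. Qed.

Lemma Fp_embed0 : Fp_embed 0 = 0. Proof. by []. Qed.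

Lemma Fp_embed1 : Fp_embed 1 = 1.
Proof. by rewrite /Fp_embed /= modn_small. Qed.

Lemma Fp_embedN c : Fp_embed (- c) = - Fp_embed c.
Proof. by apply: (addrI (Fp_embed c)); rewrite -Fp_embedD !subrr. Qed.

Lemma Fp_embed_inj : injective Fp_embed.
Proof.
suff inj0 c : Fp_embed c = 0 -> c = 0.
  move=> c d cd; apply/eqP; rewrite -subr_eq0; apply/eqP/inj0.
  apply: (addIr (Fp_embed d)).
  by rewrite -Fp_embedD subrK add0r.
move/eqP; rewrite -(dvdn_pcharf chF) => pc; apply/val_inj/eqP => /=.
have : (c < p)%N by rewrite -[X in (_ < X)%N](Fp_cast p_pr) ltn_ord.
by apply: contraTT => c0; rewrite -leqNgt; apply: dvdn_leq pc; rewrite lt0n.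
Qed.

Lemma Fp_embed_eq0 c : (Fp_embed c == 0) = (c == 0).
Proof. by rewrite -Fp_embed0 (inj_eq Fp_embed_inj). Qed.

Lemma Fp_embedX c k : Fp_embed (c ^+ k) = Fp_embed c ^+ k.
Proof. by elim: k => [|k IHk]; rewrite ?Fp_embed1 // !exprS Fp_embedM IHk. Qed.

Lemma Fp_embed_prod (I : finType) (f : I -> 'F_p) :
  Fp_embed (\prod_i f i) = \prod_i Fp_embed (f i).
Proof. exact: (big_morph _ Fp_embedM Fp_embed1). Qed.

Lemma Fp_embed_frob c m : Fp_embed c ^+ (p ^ m) = Fp_embed c.
Proof.
elim: m => [|m IHm]; first by rewrite expr1.
by rewrite expnSr exprM IHm -(pFrobenius_autE chF) rmorph_nat.
Qed.

End PrimeSubfield.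

Section TraceForm.

Variables (F : finFieldType) (p n : nat) (tr : F -> 'F_p).
Hypothesis p_pr : prime p.
Hypothesis p_odd : odd p.
Hypothesis cardF : #|F| = (p ^ n)%N.
Hypothesis trE : forall y, Fp_embed F (tr y) = \sum_(i < n) y ^+ (p ^ i).

Let chF : p \in [pchar F] := card_finPcharP cardF p_pr.
Let iota := @Fp_embed F p.

Lemma traceD x y : tr (x + y) = tr x + tr y.
Proof.
apply: (Fp_embed_inj chF); rewrite (Fp_embedD chF) !trE -big_split /=.
by apply: eq_bigr => i _; rewrite (exprD_pcharX chF).
Qed.

Lemma traceZ c y : tr (iota c * y) = c * tr y.
Proof.
apply: (Fp_embed_inj chF); rewrite (Fp_embedM chF) !trE mulr_sumr /=.
by apply: eq_bigr => i _; rewrite exprMn (Fp_embed_frob chF).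
Qed.

Lemma trace0 : tr 0 = 0.
Proof. by apply: (addrI (tr 0)); rewrite -traceD !addr0. Qed.

Lemma traceN x : tr (- x) = - tr x.
Proof. by apply: (addrI (tr x)); rewrite -traceD !subrr trace0. Qed.

Lemma trace_sum (I : finType) (f : I -> F) : tr (\sum_i f i) = \sum_i tr (f i).
Proof. exact: (big_morph _ traceD trace0). Qed.

Lemma degree_gt0 : (0 < n)%N.
Proof. by case: n cardF => // cF; have := finNzRing_gt1 F; rewrite cF. Qed.

Lemma trace_frob x : tr (x ^+ p) = tr x.
Proof.
apply: (Fp_embed_inj chF); rewrite !trE; have := cardF.
case: n degree_gt0 => // n' _ cF; rewrite big_ord_recr [RHS]big_ord_recl /= addrC.
rewrite -exprM -expnS -cF expf_card expr1; congr (_ + _).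
by apply: eq_bigr => i _; rewrite -exprM -expnS /bump leq0n.
Qed.

(** The trace is a polynomial of degree [p ^ (n - 1)], too small to vanish on all [p ^ n]
    elements. *)
Lemma trace_nontriv : exists x, tr x != 0.
Proof.
pose P : {poly F} := \sum_(i < n) 'X^(p ^ i).
have p_gt1 := prime_gt1 p_pr.
have szP : size P = (p ^ n.-1).+1.
  rewrite /P -(prednK degree_gt0) big_ord_recr /= addrC size_polyDl size_polyXn //.
  rewrite ltnS; apply: (leq_trans (size_sum _ _ _)); apply/bigmax_leqP => i _.
  by rewrite size_polyXn ltn_exp2l.
have P0 : P != 0 by rewrite -size_poly_gt0 szP.
apply/existsP; apply: contraT; rewrite negb_exists => /forallP tr0.
have : (size (enum F) < size P)%N.
  apply: max_poly_roots; rewrite ?enum_uniq //; apply/allP => x _.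
  rewrite /root /P horner_sum; under eq_bigr do rewrite hornerXn.
  by rewrite -trE (Fp_embed_eq0 chF) -[_ == _]negbK tr0.
by rewrite -cardE szP ltnS cardF leqNgt ltn_exp2l // prednK ?degree_gt0 // leqnn.
Qed.

(** Families are indexed by [nat] so that extending one by a vector does not change its type. *)
Definition orthogonal_family k (b : nat -> F) :=
  (forall i, (i < k)%N -> tr (b i * b i) != 0) /\
  (forall i j, (i < k)%N -> (j < k)%N -> i != j -> tr (b i * b j) = 0).

Definition orth_proj k (b : nat -> F) (y : F) : F :=
  \sum_(i < k) iota (tr (y * b i) / tr (b i * b i)) * b i.

Lemma trace_lin_comb k b (c : 'I_k -> 'F_p) (j : 'I_k) :
  orthogonal_family k b ->
  tr ((\sum_(i < k) iota (c i) * b i) * b j) = c j * tr (b j * b j).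
Proof.
move=> [_ orth]; rewrite mulr_suml trace_sum (bigD1 j) //= -mulrA traceZ.
rewrite big1 ?addr0 // => i ij; rewrite -mulrA traceZ orth ?mulr0 //.
Qed.

Lemma orth_projP k b y j : orthogonal_family k b -> (j < k)%N ->
  tr ((y - orth_proj k b y) * b j) = 0.
Proof.
move=> ob jk; rewrite mulrBl traceD traceN /orth_proj.
rewrite (@trace_lin_comb k b _ (Ordinal jk)) //= divfK ?subrr //.
by have [-> //] := ob.
Qed.

(** Gram-Schmidt. For [k < n] the combinations of the family are fewer than [p ^ n], so its
    orthogonal complement [W] is nonzero; the extension needs a vector of [W] that is not
    isotropic. *)
Lemma orthogonal_family_exists k : (k <= n)%N -> exists b, orthogonal_family k b.
Proof.
elim: k => [|k IHk] k_n; first by exists (fun=> 0).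
have [b ob] := IHk (ltnW k_n).
pose W w := forall i, (i < k)%N -> tr (w * b i) = 0.
have [w1 [w1W w10]] : exists w, W w /\ w != 0.
  pose lin (c : {ffun 'I_k -> 'F_p}) := \sum_(i < k) iota (c i) * b i.
  have [x xlin] : exists x, x \notin codom lin.
    apply/existsP; apply: contraT; rewrite negb_exists => /forallP all_lin.
    have : (#|F| <= #|codom lin|)%N.
      by apply/subset_leq_card/subsetP => x _; rewrite -[_ \in _]negbK all_lin.
    move/leq_trans/(_ (leq_image_card _ _)).
    by rewrite card_ffun card_Fp // card_ord cardF leq_exp2l ?prime_gt1 // leqNgt k_n.
  exists (x - orth_proj k b x); split; first by move=> i; apply: orth_projP.
  rewrite subr_eq0; apply: contraNneq xlin => ->; apply/codomP.
  exists [ffun i : 'I_k => tr (x * b i) / tr (b i * b i)].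
  by apply: eq_bigr => i _; rewrite ffunE.
have [w [wW ww]] : exists w, W w /\ tr (w * w) != 0.
  suff /existsP[w /andP[/forallP wW ww]] :
      [exists w, [forall i : 'I_k, tr (w * b i) == 0] && (tr (w * w) != 0)].
    by exists w; split=> // i ik; apply/eqP: (wW (Ordinal ik)).
  apply: contraT; rewrite negb_exists => /forallP no.
  have isotropic w : W w -> tr (w * w) = 0.
    move=> wW; have := no w; rewrite negb_and negbK => /orP[|/eqP //].
    by case/forallPn=> i; rewrite wW ?eqxx.
  (* If [W] were totally isotropic, polarisation in odd characteristic would make [w1] orthogonal to
     [W], hence to every element; but [y] is chosen so that [tr (w1 * y) = tr x0]. *)
  have [x0 x00] := trace_nontriv; pose y := w1^-1 * x0.
  have [w' w'W yE] : exists2 w', W w' & y = orth_proj k b y + w'.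
    exists (y - orth_proj k b y); last by rewrite addrC subrK.
    by move=> i; apply: orth_projP.
  have : tr (w1 * y) != 0 by rewrite mulrA divff // mul1r.
  rewrite yE mulrDr traceD mulr_sumr trace_sum big1 ?add0r => [|i _]; last first.
    by rewrite mulrCA traceZ w1W ?mulr0.
  have : tr ((w1 + w') * (w1 + w')) = 0.
    by apply: isotropic => i ik; rewrite mulrDl traceD w1W // w'W // addr0.
  rewrite mulrDl !mulrDr !traceD (isotropic w1) // (isotropic w') //.
  rewrite add0r addr0 [w' * _]mulrC.
  rewrite -mulr2n -mulr_natr => /eqP; rewrite mulf_eq0.
  rewrite (negbTE (pchar_odd_two_neq0 (pchar_Fp p_pr) p_odd)) orbF.
  by move=> ->.
pose b' i := if i == k then w else b i.
have [b_ne b_orth] := ob; exists b'; split=> [i|i j]; rewrite /b' !ltnS.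
  by rewrite leq_eqVlt; case: eqP => //= _; apply: b_ne.
rewrite [(i <= _)%N]leq_eqVlt [(j <= _)%N]leq_eqVlt.
case: (eqVneq i k) => [->|_]; case: (eqVneq j k) => [->|_] //=; rewrite ?eqxx //.
- by move=> _ jk _; apply: wW.
- by move=> ik _ _; rewrite mulrC; apply: wW.
exact: b_orth.
Qed.

Section Discriminant.

Variable b : nat -> F.
Hypothesis ob : orthogonal_family n b.

Lemma orth_lin_comb_bij : bijective (fun c : {ffun 'I_n -> 'F_p} =>
  \sum_(i < n) iota (c i) * b i).
Proof.
apply: inj_card_bij; last by rewrite card_ffun card_Fp // card_ord cardF.
move=> c d cd; apply/ffunP => j; have [b_ne _] := ob.
apply: (mulIf (b_ne j (ltn_ord j))).
by rewrite -!(trace_lin_comb _ _ ob) cd.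
Qed.

Lemma disc_sqr : exists delta : F,
  [/\ delta ^+ 2 = iota (\prod_(i < n) tr (b i * b i)),
      delta != 0 & delta ^+ p = (-1) ^+ n.-1 * delta].
Proof.
pose V := \matrix_(i < n, j < n) (b j ^+ (p ^ i)).
exists (\det V).
(* The product is the Gram matrix of the trace form, diagonal because [b] is orthogonal. *)
have V2 : V^T *m V = diag_mx (\row_i iota (tr (b i * b i))).
  apply/matrixP => i j; rewrite !mxE.
  under eq_bigr do rewrite !mxE -exprMn.
  rewrite -trE; have [<-|ij] := eqVneq i j; first by rewrite mulr1n.
  by rewrite mulr0n ob.2.
have det2 : (\det V) ^+ 2 = iota (\prod_(i < n) tr (b i * b i)).
  rewrite expr2 -{1}det_tr -det_mulmx V2 det_diag /iota (Fp_embed_prod chF).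
  by apply: eq_bigr => i _; rewrite mxE.
split=> //.
  suff : \det V ^+ 2 != 0 by rewrite expf_eq0.
  rewrite det2 /iota (Fp_embed_eq0 chF); apply/prodf_neq0 => i _.
  exact: ob.1.
rewrite -(pFrobenius_autE chF) -det_map_mx.
have := cardF; rewrite {det2 V2}/V; case: (n) degree_gt0 => // n' _ cF.
(* The cyclic shift: the last index goes to [0], any other [i] to [i + 1]. *)
pose s := lift_perm (ord_max : 'I_n'.+1) ord0 1%g.
rewrite (_ : map_mx _ _ = row_perm s (\matrix_(i < n'.+1, j < n'.+1) (b j ^+ (p ^ i)))).
  rewrite row_permE det_mulmx det_perm odd_lift_perm odd_perm1 /= addbF addbF.
  by rewrite signr_odd.
apply/matrixP => i j; rewrite !mxE /= (pFrobenius_autE chF) -exprM -expnSr.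
case: (unliftP ord_max i) => [i' ->|->].
  by rewrite lift_perm_lift perm1 /= /bump leq0n leqNgt ltn_ord.
by rewrite lift_perm_id /= -cF expf_card expr1.
Qed.

End Discriminant.

End TraceForm.

(** * Quadratic sums *)

Section QuadraticCharacter.

Variables (F : finFieldType) (p : nat).
Hypothesis chF : p \in [pchar F].
Hypothesis p_odd : odd p.
Let N := #|F|.-1.

Lemma neq_oppr (x : F) : x != 0 -> x != - x.
Proof.
move=> x0; rewrite -addr_eq0 -mulr2n -mulr_natl mulf_eq0 negb_or x0 andbT.
exact: (pchar_odd_two_neq0 chF).
Qed.

Lemma quad_char_cases (a : F) : a != 0 -> quad_char a = 1 \/ quad_char a = -1.
Proof. by move=> a0; rewrite /quad_char (negbTE a0); case: ifP; [left|right]. Qed.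

Lemma card_sqr_fiber (r : F) : r != 0 -> #|[set x : F | x ^+ 2 == r ^+ 2]| = 2%N.
Proof.
move=> r0; rewrite -[RHS](_ : #|[set r; - r]| = 2%N); last first.
  by rewrite cards2 neq_oppr.
by apply: eq_card => x; rewrite !inE eqf_sqr.
Qed.

Hypothesis even_N : (2 %| N)%N.

(** Euler's criterion: the power is a square root of [1], equal to [1] only for squares. *)
Lemma quad_charE (a : F) : a != 0 -> (quad_char a)%:~R = a ^+ (N %/ 2).
Proof.
move=> a0; rewrite /quad_char (negbTE a0).
case: (is_powerP even_N a0) => [[z za]|nz].
  rewrite ifT; last by apply/existsP; exists z; rewrite za.
  apply/esym/eqP/(is_powerP even_N a0).
  by exists z.
rewrite ifF; last by apply/existsP => -[z /eqP za]; apply: nz; exists z.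
have : (a ^+ (N %/ 2)) ^+ 2 == 1 ^+ 2.
  by rewrite -exprM divnK // expr1n finField_expf_pred.
rewrite eqf_sqr => /orP[/(is_powerP even_N a0)//|/eqP ->].
by rewrite rmorphN1.
Qed.

(** A square factor is absorbed by a substitution. For a nonsquare [a], the values of [x ^+ 2] and
    [a * x ^+ 2] together hit every element exactly twice, so the two sums cancel. *)
Lemma quad_sum_quad_char (C : numClosedFieldType) (psi : F -> C) (a : F) :
  add_character psi -> a != 0 ->
  \sum_x psi (a * x ^+ 2) = (quad_char a)%:~R * \sum_x psi (x ^+ 2).
Proof.
move=> psiC a0; rewrite /quad_char (negbTE a0); case: ifP => [/existsP[b /eqP ab]|].
  have b0 : b != 0 by apply: contra_neq a0 => b0; rewrite ab b0 expr0n.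
  rewrite mul1r [RHS](reindex_inj (mulfI b0)) /=; apply: eq_bigr => x _.
  by rewrite exprMn ab.
move/negbT/existsPn => nsq; rewrite rmorphN1 mulN1r; apply/eqP; rewrite -addr_eq0.
pose c (u y : F) := #|[set x : F | u * x ^+ 2 == y]|.
have fib u : \sum_x psi (u * x ^+ 2) = \sum_y psi y *+ c u y.
  rewrite (partition_big (fun x => u * x ^+ 2) xpredT) //=; apply: eq_bigr => y _.
  rewrite (eq_bigr (fun=> psi y)) => [|x /eqP -> //].
  by rewrite sumr_const /c; congr (_ *+ _); apply: eq_card => x; rewrite inE.
have -> : \sum_x psi (x ^+ 2) = \sum_x psi (1 * x ^+ 2).
  by apply: eq_bigr => x _; rewrite mul1r.
rewrite !fib -big_split /= (eq_bigr (fun y => psi (1 * y) *+ 2)).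
  by rewrite sumrMnl addchar_sum // oner_eq0 mul0rn.
move=> y _; rewrite -mulrnDr mul1r; congr (_ *+ _).
have [->|y0] := eqVneq y 0.
  have c0 u : u != 0 -> c u 0 = 1%N.
    move=> u0; apply/eqP/cards1P; exists 0; apply/setP => x.
    by rewrite !inE mulf_eq0 (negbTE u0) expf_eq0.
  by rewrite !c0 ?oner_eq0.
have c2 u r : u * r ^+ 2 = y -> c u y = 2%N.
  move=> ur; have u0 : u != 0 by apply: contra_neq y0 => u0; rewrite -ur u0 mul0r.
  have r0 : r != 0 by apply: contra_neq y0 => r0; rewrite -ur r0 expr0n mulr0.
  rewrite -(card_sqr_fiber r0); apply: eq_card => x.
  by rewrite !inE -ur (inj_eq (mulfI u0)).
have c0 u : (forall r, u * r ^+ 2 != y) -> c u y = 0%N.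
  move=> nr; apply/eqP; rewrite cards_eq0; apply/eqP/setP => x.
  by rewrite !inE (negbTE (nr x)).
have sqE (z : F) : z != 0 -> ~~ [exists b, z == b ^+ 2] -> z ^+ (N %/ 2) = -1.
  move=> z0 nz; rewrite -quad_charE // /quad_char (negbTE z0) (negbTE nz).
  by rewrite rmorphN1.
have [/existsP[r /eqP yr]|ny] := boolP [exists r, y == r ^+ 2].
  have r0 : r != 0 by apply: contra_neq y0 => r0; rewrite yr r0 expr0n.
  rewrite [c a y]c0 => [|x]; first by rewrite (c2 _ r) ?mul1r.
  apply/eqP => xy; have x0 : x != 0.
    by apply: contra_neq y0 => x0; rewrite -xy x0 expr0n mulr0.
  have /negP[] := nsq (r / x); rewrite expr_div_n -yr -xy mulfK ?expf_neq0 //.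
(* By Euler's criterion the quotient of two nonsquares is a square. *)
have /(is_powerP even_N)[|r ray] : (y / a) ^+ (N %/ 2) == 1.
    rewrite expr_div_n !sqE //; last by apply/existsPn.
    by rewrite divff ?oppr_eq0 ?oner_eq0.
  by rewrite mulf_neq0 ?invr_neq0.
rewrite (c2 a r) ?ray ?[a * _]mulrC ?divfK // c0 // => x.
by rewrite mul1r eq_sym; apply: contra ny => xy; apply/existsP; exists x.
Qed.

End QuadraticCharacter.

Section QuadraticSumLift.

Variables (F : finFieldType) (p n : nat) (tr : F -> 'F_p).
Hypothesis p_pr : prime p.
Hypothesis p_odd : odd p.
Hypothesis cardF : #|F| = (p ^ n)%N.
Hypothesis trE : forall y, Fp_embed F (tr y) = \sum_(i < n) y ^+ (p ^ i).
Variables (C : numClosedFieldType) (chi : 'F_p -> C).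
Hypothesis chiC : add_character chi.

Let chF : p \in [pchar F] := card_finPcharP cardF p_pr.

Lemma addchar_trace : add_character (chi \o tr).
Proof.
split=> [|x y|x|] /=.
- by rewrite (trace0 p_pr cardF trE) addchar0.
- by rewrite (traceD p_pr cardF trE) addcharD.
- by rewrite addchar_conj // (traceN p_pr cardF trE).
have [x0 x00] := trace_nontriv p_pr cardF trE.
have [c chic] := addchar_nontriv chiC.
exists (Fp_embed F (c / tr x0) * x0).
by rewrite (traceZ p_pr cardF trE) divfK.
Qed.

Lemma addchar_trace_frob x : (chi \o tr) (x ^+ p) = (chi \o tr) x.
Proof. by rewrite /= (trace_frob p_pr cardF trE). Qed.

Lemma even_Fp_pred : (2 %| #|'F_p|.-1)%N.
Proof. by rewrite card_Fp // dvdn2 -subn1 oddB ?prime_gt0 // p_odd. Qed.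

(** The quadratic case of the Hasse-Davenport relation: in an orthogonal basis the sum factors into
    [n] Gauss sums, each twisted by the quadratic character of a diagonal coefficient. *)
Lemma quad_sum_lift :
  \sum_x chi (tr (x ^+ 2)) = (-1) ^+ n.-1 * (\sum_c chi (c ^+ 2)) ^+ n.
Proof.
have [b ob] := orthogonal_family_exists p_pr p_odd cardF trE (leqnn n).
have := disc_sqr p_pr cardF trE ob; set D := \prod_(i < n) _ => -[delta [d2 d0 dp]].
have chP := pchar_Fp p_pr.
(* By Euler's criterion the product becomes [delta ^ (p - 1)] in [F]; since [1] and [-1] differ
   there, the equality of signs lifts to the integers. *)
have prodE : \prod_(i < n) quad_char (tr (b i * b i)) = (-1) ^+ n.-1.
  have E : (\prod_(i < n) quad_char (tr (b i * b i)))%:~R = (-1) ^+ n.-1 :> F.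
    have : Fp_embed F (D ^+ (#|'F_p|.-1 %/ 2)) = (-1) ^+ n.-1.
      rewrite (Fp_embedX chF) -d2 -exprM mulnC divnK ?even_Fp_pred // card_Fp //.
      by apply: (mulIf d0); rewrite -exprSr prednK ?prime_gt0.
    move=> <-; rewrite /D -prodrXl (Fp_embed_prod chF) rmorph_prod.
    apply: eq_bigr => i _; have [b_ne _] := ob; have bi0 := b_ne i (ltn_ord i).
    rewrite -(quad_charE even_Fp_pred) //.
    by case: (quad_char_cases bi0) => ->;
      rewrite ?Fp_embed1 // !rmorphN1 (Fp_embedN chF) Fp_embed1.
  have P1 : \prod_(i < n) quad_char (tr (b i * b i)) = 1
         \/ \prod_(i < n) quad_char (tr (b i * b i)) = -1.
    apply: (big_ind (fun z => z = 1 \/ z = -1)) => [|x y [] -> [] ->|i _].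
    - by left.
    - by left.
    - by right.
    - by right.
    - by left.
    by apply: quad_char_cases; have [b_ne _] := ob; apply: b_ne.
  have one_neq : (1 : F) != -1 by apply: (neq_oppr chF p_odd); rewrite oner_eq0.
  have sgn (z : int) (e : bool) : z = 1 \/ z = -1 ->
      z%:~R = (-1) ^+ e :> F -> z = (-1) ^+ e.
    case=> ->; case: e; rewrite ?expr1 ?expr0 // ?rmorphN1 => E1; case/eqP: one_neq.
      exact: E1.
    exact: esym E1.
  by rewrite -signr_odd; apply: sgn; rewrite ?signr_odd.
pose lin (c : {ffun 'I_n -> 'F_p}) := \sum_(i < n) Fp_embed F (c i) * b i.
rewrite (reindex lin) /=; last first.
  exact/onW_bij/(orth_lin_comb_bij p_pr cardF trE ob).
have -> : \sum_(c : {ffun 'I_n -> 'F_p}) chi (tr (lin c ^+ 2))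
    = \sum_(c : {ffun 'I_n -> 'F_p}) \prod_(i < n) chi (tr (b i * b i) * c i ^+ 2).
  apply: eq_bigr => c _; rewrite expr2 {2}/lin mulr_sumr (trace_sum p_pr cardF trE).
  rewrite (big_morph chi (addcharD chiC) (addchar0 chiC)).
  apply: eq_bigr => i _; congr chi.
  rewrite mulrCA (traceZ p_pr cardF trE) (trace_lin_comb p_pr cardF trE _ _ ob).
  by rewrite mulrA mulrC expr2.
rewrite -(bigA_distr_bigA
  (fun (i : 'I_n) (c : 'F_p) => chi (tr (b i * b i) * c ^+ 2))) /=.
rewrite (eq_bigr (fun i : 'I_n => (quad_char (tr (b i * b i)))%:~R
    * \sum_c chi (c ^+ 2))) => [|i _].
  by rewrite big_split /= prodr_const card_ord -rmorph_prod /= prodE rmorphXn /= rmorphN1.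
rewrite (quad_sum_quad_char chP p_odd even_Fp_pred) //.
by have [b_ne _] := ob; apply: b_ne.
Qed.

End QuadraticSumLift.

Local Open Scope complex_scope.

(** * The Gauss sum over the prime field *)

Section GaussSum.

Variables (R : realType) (p : nat).
Hypothesis p_pr : prime p.
Hypothesis p_odd : odd p.

Let theta : R := 2 * pi / p%:R.
Let omega : R[i] := cos theta +i* sin theta.
Let h := p./2.

Lemma de_moivre (t : R) k : (cos t +i* sin t) ^+ k = cos (t * k%:R) +i* sin (t * k%:R).
Proof.
elim: k => [|k IHk]; first by rewrite mulr0 cos0 sin0.
rewrite exprS IHk -[k.+1%:R]natr1 mulrDr mulr1 addrC cosD sinD.
by apply/eqP; rewrite eq_complex /= [X in _ && (_ == X)]addrC !eqxx.
Qed.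

Lemma expC_omega (k : nat) :
  cexp (2 * (pi : R)%:C * 'i%C * k%:R / p%:R) = omega ^+ k.
Proof.
have -> : 2 * (pi : R)%:C * 'i%C * k%:R / p%:R = 0 +i* (theta * k%:R).
  have -> : 0 +i* (theta * k%:R) = 'i%C * (theta * k%:R)%:C.
    by apply/eqP; rewrite eq_complex /=; apply/andP; split; apply/eqP; ring.
  rewrite /theta !rmorphM fmorphV !rmorph_nat.
  by ring.
by rewrite /cexp /= expR0 mul1r de_moivre.
Qed.

Let p_gt2 : (2 < p)%N.
Proof. by have := prime_gt1 p_pr; case: (p) p_odd => [|[|[|]]]. Qed.

Let pR_gt0 : 0 < p%:R :> R.
Proof. by rewrite ltr0n prime_gt0. Qed.

Lemma omega_prim : p.-primitive_root omega.
Proof.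
have wp : omega ^+ p = 1.
  rewrite /omega de_moivre /theta divfK ?gt_eqF // mulrC mulr_natr.
  by rewrite cos2pi sin2pi.
(* As [p > 2], the angle lies strictly between [0] and [pi], so the imaginary part is positive. *)
have w1 : omega != 1.
  apply/eqP => /(congr1 (@complex.Im R)) /= /eqP; rewrite gt_eqF //.
  apply: sin_gt0_pi; rewrite /theta divr_gt0 ?mulr_gt0 ?pi_gt0 //=.
  rewrite ltr_pdivrMr // mulrC ltr_pM2l ?pi_gt0 //.
  by rewrite ltr_nat.
have [m pm mp] := prim_order_exists (prime_gt0 p_pr) wp.
have := prime_nt_dvdP p_pr; move: pm; case: (primeP p_pr) => _ /(_ m mp).
case/orP => /eqP -> // pm _.
by have := prim_expr_order pm; rewrite expr1 => /eqP; rewrite (negbTE w1).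
Qed.

Lemma omega_conj k : Num.conj (omega ^+ k) = omega ^- k.
Proof.
rewrite rmorphXn -exprVn; congr (_ ^+ _); apply: (mulIf (x := omega)).
  by rewrite (prim_root_eq0 omega_prim) -lt0n prime_gt0.
rewrite mulVf; last by rewrite (prim_root_eq0 omega_prim) -lt0n prime_gt0.
apply/eqP; rewrite eq_complex /= mulNr opprK -!expr2 cos2Dsin2 eqxx /=.
by rewrite mulNr mulrC subrr.
Qed.

Definition Fp_char (c : 'F_p) : R[i] := omega ^+ c.

Lemma Fp_char_add_character : add_character Fp_char.
Proof.
have D (c d : 'F_p) : Fp_char (c + d) = Fp_char c * Fp_char d.
  rewrite /Fp_char -exprD /= [X in (_ %% X)%N]Fp_cast //.
  by rewrite (prim_expr_mod omega_prim).
have F0 : Fp_char 0 = 1 by [].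
split=> // [x|].
  have x0 : Fp_char x != 0.
    by rewrite expf_neq0 // (prim_root_eq0 omega_prim) -lt0n prime_gt0.
  apply: (mulIf x0); rewrite -D addNr F0 omega_conj mulVf //.
exists 1; rewrite /Fp_char /= modn_small // expr1.
have := prim_order_dvd omega_prim 1; rewrite expr1 => <-.
by rewrite dvdn1 neq_ltn prime_gt1 ?orbT.
Qed.

Let ph : p = h.*2.+1. Proof. by rewrite -[LHS]odd_double_half p_odd. Qed.

Lemma gauss_sum_sines :
  \sum_c Fp_char (c ^+ 2)
  = \prod_(i < h) (2%:R * 'i%C * (sin (theta * i.*2.+1%:R))%:C).
Proof.
transitivity (\sum_(j < p) omega ^+ (j ^ 2)).
  rewrite -(big_mkord xpredT (fun j => omega ^+ (j ^ 2))).
  rewrite -[X in index_iota _ X](Fp_cast p_pr) big_mkord; apply: eq_bigr => c _.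
  rewrite /Fp_char expr2 /= [X in (_ %% X)%N]Fp_cast //.
  by rewrite (prim_expr_mod omega_prim).
rewrite (quad_sum_prod p_odd omega_prim); apply: eq_bigr => i _.
rewrite -omega_conj /omega de_moivre.
by apply/eqP; rewrite eq_complex /=; apply/andP; split; apply/eqP; ring.
Qed.

(** The angle [2 * pi * (2 * i + 1) / p] stays below [2 * pi], and it exceeds [pi] exactly when
    [2 * i >= h], because [p = 2 * h + 1]. *)
Lemma sine_sign (i : 'I_h) :
  0 < (-1) ^+ (uphalf h <= i)%N * sin (theta * i.*2.+1%:R).
Proof.
have pi0 := pi_gt0 R; set k := i.*2.+1.
have tE : theta * k%:R = pi * ((2 * k)%N%:R / p%:R).
  by rewrite /theta natrM; ring.
have lt_ih := ltn_ord i; have hE := uphalf_half h; have hE2 := odd_double_half h.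
rewrite tE; case: leqP => le_i.
  have p_lt : (p < 2 * k)%N by rewrite /k ph; lia.
  have k_lt : (2 * k - p < p)%N by rewrite /k ph; lia.
  have -> : pi * ((2 * k)%N%:R / p%:R) = pi * ((2 * k - p)%N%:R / p%:R) + pi :> R.
    rewrite natrB; last exact: ltnW.
    by field; rewrite gt_eqF.
  rewrite expr1 mulN1r sinDpi opprK; apply: sin_gt0_pi; apply/andP; split.
    by rewrite mulr_gt0 ?divr_gt0 ?ltr0n ?subn_gt0 ?prime_gt0.
  by rewrite gtr_pMr // ltr_pdivrMr // mul1r ltr_nat.
have k_lt : (2 * k < p)%N by rewrite /k ph; lia.
rewrite -[nat_of_bool false]/0%N expr0 mul1r; apply: sin_gt0_pi; apply/andP; split.
  apply: mulr_gt0 => //; apply: divr_gt0 => //; rewrite ltr0n; lia.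
by rewrite gtr_pMr // ltr_pdivrMr // mul1r ltr_nat.
Qed.

Lemma imaginary_pow4 a b : ('i%C : R[i]) ^+ (4 * a + b) = 'i%C ^+ b.
Proof.
by rewrite exprD exprM (exprM _ 2 2) sqr_i expr2 mulrNN mulr1 expr1n mul1r.
Qed.

Lemma gauss_sum_prime :
  \sum_c Fp_char (c ^+ 2) = 'i%C ^+ (h ^ 2) * (Num.sqrt p%:R : R)%:C.
Proof.
pose r : R := \prod_(i < h) (2%:R * ((-1) ^+ (uphalf h <= i)%N
   * sin (theta * i.*2.+1%:R))).
have r_gt0 : 0 < r.
  by apply: prodr_gt0 => i _; rewrite mulr_gt0 ?ltr0n ?sine_sign.
have sgnE : \prod_(i < h) (-1) ^+ (uphalf h <= i)%N = (-1) ^+ h./2 :> R[i].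
  have E (u k : nat) :
      \prod_(i < k) (-1) ^+ (u <= i)%N = (-1) ^+ (k - u) :> R[i].
    elim: k => [|k IHk]; first by rewrite big_ord0.
    rewrite big_ord_recr /= IHk -exprD; congr (_ ^+ _).
    by case: leqP => /=; lia.
  by rewrite E; congr (_ ^+ _); rewrite uphalf_half; have := odd_double_half h; lia.
have GE : \sum_c Fp_char (c ^+ 2) = 'i%C ^+ (h ^ 2) * r%:C.
  rewrite gauss_sum_sines.
  transitivity ('i%C ^+ h * ((-1) ^+ h./2 * r%:C) : R[i]).
    rewrite -sgnE /r rmorph_prod -[X in 'i%C ^+ X](card_ord h) -prodr_const.
    rewrite -!big_split /=; apply: eq_bigr => i _.
    rewrite !rmorphM rmorph_sign /= [X in _ = X](_ : _ =
      ((-1) ^+ (uphalf h <= i)%N) ^+ 2 * (2 * 'i%C * (sin (theta * i.*2.+1%:R))%:C)).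
      by rewrite sqrr_sign mul1r.
    by rewrite rmorph_nat; ring.
  rewrite mulrA; congr (_ * _).
  rewrite -[-1](sqr_i R) -exprM -exprD.
  (* The sine signs contribute [2 * h./2] to the exponent of [i], and the factors [2 * i] contribute
     [h]; modulo [4] the total is [h ^ 2]. *)
  have [t ->] : exists t, (h ^ 2 = 4 * t + (2 * h./2 + h))%N.
    have := odd_double_half h; case: (odd h) => /= <-.
      by exists (h./2 ^ 2)%N; rewrite -!mulnn -muln2; lia.
    by exists (h./2 * h./2.-1)%N; case: (h./2) => // k; rewrite -!mulnn -muln2; lia.
  by rewrite imaginary_pow4 addnC.
rewrite GE; congr (_ * _%:C).
have chP := pchar_Fp p_pr.
have frob x : Fp_char (x ^+ p) = Fp_char x.
  by have := expf_card x; rewrite card_Fp // => ->.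
(* The modulus is the case [Q = p ^ 0 = 1]: the exponent [Q + 1] is [2] and the kernel equation
   becomes [2 * z = 0]. *)
have := sqr_norm_herm_sum Fp_char_add_character 0 1 chP p_odd frob.
have -> : herm_kernel p 0 (1 : 'F_p) = [set 0].
  apply/setP => z; rewrite !inE expr1 !mul1r expr1 -mulr2n -mulr_natl mulf_eq0.
  rewrite -(dvdn_pcharf chP) (_ : (p %| 2)%N = false) //.
  by apply/negP => /dvdn_leq => /(_ isT); rewrite leqNgt p_gt2.
rewrite cards1 mulr1 card_Fp //=.
under eq_bigr do rewrite mul1r.
rewrite GE rmorphM rmorphXn /= mulrACA -exprMn.
have -> : 'i%C * Num.conj 'i%C = 1 :> R[i].
  by apply/eqP; rewrite eq_complex /=; apply/andP; split; apply/eqP; ring.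
have -> : Num.conj r%:C = r%:C by apply/eqP; rewrite eq_complex /= oppr0 !eqxx.
rewrite expr1n mul1r -rmorphM -(rmorph_nat (real_complex R)).
move/(congr1 (@complex.Re R)) => /= <-.
by rewrite -expr2 sqrtr_sqr gtr0_norm.
Qed.

End GaussSum.

(** * Evaluation of the sums *)

(** Modulo [x + 1], [x] is [-1], and so are its odd powers. *)
Lemma dvdn_succ_expn_odd x t : odd t -> (x.+1 %| (x ^ t).+1)%N.
Proof.
move=> t_odd; rewrite -[t]odd_double_half t_odd add1n.
elim: (t./2) => [|k IHk]; first by rewrite expn1.
case: x IHk => [|x] IHk; first by rewrite dvd1n.
rewrite -(dvdn_addl (n := (x.+2 * x)%N)) ?dvdn_mulr //.
have -> : ((x.+1 ^ k.+1.*2.+1).+1 + x.+2 * x = (x.+1 ^ 2) * (x.+1 ^ k.*2.+1).+1)%N.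
  by rewrite doubleS (expnD _ 2 k.*2.+1) -mulnn; lia.
by rewrite dvdn_mull.
Qed.

Lemma dvdn_pred_expn x j : ((x).-1 %| (x ^ j).-1)%N.
Proof. by rewrite [X in (_ %| X)%N]predn_exp dvdn_mulr. Qed.

(** Modulo a common divisor, [p ^ (alpha * t)] is [-1] as an odd power of [p ^ alpha], and [1] as a
    power of [p ^ n]; so the divisor divides [2]. *)
Lemma gcdn_expn_succ_pred2 p n alpha t : odd p -> (0 < n)%N -> odd t ->
  (n %| alpha * t)%N -> gcdn (p ^ alpha).+1 (p ^ n).-1 = 2%N.
Proof.
move=> p_odd n_gt0 t_odd /dvdnP[j nt]; apply/eqP; rewrite eqn_dvd; apply/andP; split.
  set r := gcdn _ _.
  have r1 : (r %| (p ^ (n * j)).-1)%N.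
    by rewrite expnM; apply: dvdn_trans (dvdn_pred_expn _ _); apply: dvdn_gcdr.
  have r2 : (r %| (p ^ (n * j)).+1)%N.
    rewrite mulnC -nt expnM; apply: dvdn_trans (dvdn_succ_expn_odd _ t_odd).
    exact: dvdn_gcdl.
  have X_gt0 : (0 < p ^ (n * j))%N by rewrite expn_gt0 odd_gt0.
  have XE : ((p ^ (n * j)).+1 = (p ^ (n * j)).-1 + 2)%N.
    by rewrite addn2 prednK.
  by move: r2; rewrite XE dvdn_addr.
rewrite dvdn_gcd !dvdn2 /= oddX p_odd orbT /=.
by rewrite -subn1 oddB ?expn_gt0 ?odd_gt0 // oddX p_odd orbT.
Qed.

(** Dividing by [m = gcdn alpha n] leaves coprime cofactors, and the valuations force that of [n] to
    be even, hence [t] odd. The parity of [s] separates cases (ii) and (iii). *)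
Lemma two_adic_split n alpha : (0 < n)%N -> (0 < alpha)%N ->
    (logn 2 alpha < logn 2 n)%N ->
  exists m t s : nat,
    [/\ alpha = (m * t)%N, n = (m * (2 * s))%N, (0 < m)%N & odd t] /\
    [/\ coprime t (2 * s), gcdn (2 * alpha) n = (2 * m)%N
      & odd s = (logn 2 n == (logn 2 alpha).+1)].
Proof.
move=> n_gt0 a_gt0 lt_log; set m := gcdn alpha n.
have m_gt0 : (0 < m)%N by rewrite gcdn_gt0 a_gt0.
have [ma mn] := (dvdn_gcdl alpha n, dvdn_gcdr alpha n).
pose t := (alpha %/ m)%N; pose u := (n %/ m)%N.
have at_ : alpha = (m * t)%N by rewrite mulnC divnK.
have nu : n = (m * u)%N by rewrite mulnC divnK.
have t_gt0 : (0 < t)%N by rewrite divn_gt0 // dvdn_leq.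
have u_gt0 : (0 < u)%N by rewrite divn_gt0 // dvdn_leq.
have co : coprime t u.
  have E : (m * gcdn t u = m * 1)%N by rewrite muln_gcdr -at_ -nu muln1.
  by move/eqP: E; rewrite eqn_pmul2l.
have lt_tu : (logn 2 t < logn 2 u)%N.
  by move: lt_log; rewrite {1}at_ {1}nu !lognM // ltn_add2l.
have u_even : (2 %| u)%N.
  have := pfactor_dvdn 1 (isT : prime 2) u_gt0; rewrite expn1 => ->.
  exact: leq_ltn_trans lt_tu.
have t_odd : odd t.
  by rewrite -coprime2n; apply: coprime_dvdl u_even _; rewrite coprime_sym.
have logt : logn 2 t = 0%N by rewrite lognE dvdn2 t_odd /= andbF.
have us : u = (2 * (u %/ 2))%N by rewrite mulnC divnK.
have s_gt0 : (0 < u %/ 2)%N by rewrite divn_gt0 // dvdn_leq.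
exists m, t, (u %/ 2)%N; rewrite -us; split=> //; split=> //.
  rewrite at_ nu us mulnCA -!muln_gcdr; rewrite mulnCA; congr (_ * _)%N.
  have : coprime t (u %/ 2) by apply: coprime_dvdr co; apply/dvdnP; exists 2%N.
  by move/eqP => ->; rewrite muln1.
have -> : logn 2 n = (logn 2 m + (logn 2 (u %/ 2)).+1)%N.
  by rewrite {1}nu lognM // {1}us lognM.
have -> : logn 2 alpha = logn 2 m by rewrite {1}at_ lognM // logt addn0.
rewrite -[(logn 2 m).+1]addn1 eqn_add2l eqSS lognE /= s_gt0 dvdn2.
by case: odd.
Qed.

(** Bezout gives [t * u = 2 * s * v + 1], with [u] odd. Modulo a common divisor, [Q ^ t] is [-1] and
    [Q ^ (2 * s)] is [1], so [Q] itself is [-1]. *)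
Lemma gcdn_expn_succ_pred p m t s : (0 < p)%N -> odd t -> coprime t (2 * s) ->
  gcdn (p ^ (m * t)).+1 (p ^ (m * (2 * s))).-1 = (p ^ m).+1.
Proof.
move=> p_gt0 t_odd co; rewrite !expnM; set Q := (p ^ m)%N.
have Q_gt0 : (0 < Q)%N by rewrite expn_gt0 p_gt0.
apply/eqP; rewrite eqn_dvd; apply/andP; split; last first.
  rewrite dvdn_gcd dvdn_succ_expn_odd //=; apply: dvdn_trans (dvdn_pred_expn _ _).
  have -> : ((Q ^ 2).-1 = Q.+1 * Q.-1)%N.
    by rewrite -mulnn; case: (Q) Q_gt0 => // Q' _; lia.
  exact: dvdn_mulr.
set r := gcdn _ _.
have [u v uv _] := egcdnP (2 * s) (odd_gt0 t_odd).
rewrite (eqP co) in uv.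
have u_odd : odd u.
  by have := congr1 odd uv; rewrite addn1 /= mulnCA oddM /= oddM => /andP[].
have r1 : (r %| (Q ^ (t * u)).+1)%N.
  by rewrite expnM; apply: dvdn_trans (dvdn_succ_expn_odd _ u_odd); apply: dvdn_gcdl.
have r2 : (r %| (Q ^ (2 * s * v)).-1)%N.
  rewrite expnM; apply: dvdn_trans (dvdn_pred_expn _ _).
  by rewrite expnM; apply: dvdn_gcdr.
move: r1; rewrite mulnC uv mulnC expnD expn1.
have Y_gt0 : (0 < Q ^ (2 * s * v))%N by rewrite expn_gt0 Q_gt0.
have -> : ((Q ^ (2 * s * v) * Q).+1 = Q * (Q ^ (2 * s * v)).-1 + Q.+1)%N.
  by case: (Q ^ _)%N Y_gt0 => // Y _; lia.
by rewrite dvdn_addr // dvdn_mull.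
Qed.

Section MonomialSums.

Variables (R : realType) (F : finFieldType) (p n : nat).
Hypothesis p_pr : prime p.
Hypothesis p_odd : odd p.
Hypothesis cardF : #|F| = (p ^ n)%N.

Let psi : F -> R[i] := @Fp_char R p \o abs_trace p n.

Let trE y : Fp_embed F (abs_trace p n y) = \sum_(i < n) y ^+ (p ^ i).
Proof. exact: abs_traceE. Qed.

Let psiC : add_character psi.
Proof. exact: addchar_trace p_pr cardF trE _ _ (Fp_char_add_character R p_pr p_odd). Qed.

Let chF : p \in [pchar F] := card_finPcharP cardF p_pr.

Let n_gt0 : (0 < n)%N := degree_gt0 cardF.

Lemma exp_sumE f : exp_sum R p n f = \sum_x psi (f x).
Proof. by apply: eq_bigr => x _; rewrite /add_char expC_omega. Qed.

Lemma exp_sum_gcd (a : F) k l : (0 < k)%N -> (0 < l)%N ->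
  gcdn k (p ^ n).-1 = gcdn l (p ^ n).-1 ->
  exp_sum R p n (fun x => a * x ^+ k) = exp_sum R p n (fun x => a * x ^+ l).
Proof.
move=> k0 l0 kl; rewrite !exp_sumE.
by apply: (@sum_expr_gcd F _ k l (fun y => psi (a * y))) => //; rewrite cardF.
Qed.

Lemma powR_half k : (p%:R : R) `^ (k%:R / 2) = Num.sqrt p%:R ^+ k.
Proof.
by rewrite mulrC powRrM powR12_sqrt ?ler0n // powR_mulrn // sqrtr_ge0.
Qed.

Lemma powR_half_double k : (p%:R : R) `^ ((2 * k)%N%:R / 2) = (p ^ k)%:R.
Proof. by rewrite powR_half exprM sqr_sqrtr ?ler0n // natrX. Qed.

Lemma quad_exp_sum (a : F) : a != 0 ->
  exp_sum R p n (fun x => a * x ^+ 2)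
  = (quad_char a)%:~R * (-1) ^+ (n - 1) * 'i%C ^+ ((p - 1) ^ 2 * n %/ 4)
    * (p%:R `^ (n%:R / 2))%:C.
Proof.
move=> a0; rewrite exp_sumE.
have even_N : (2 %| #|F|.-1)%N.
  by rewrite cardF dvdn2 -subn1 oddB ?expn_gt0 ?prime_gt0 // oddX p_odd orbT.
rewrite (quad_sum_quad_char chF p_odd even_N psiC a0).
rewrite (quad_sum_lift p_pr p_odd cardF trE (Fp_char_add_character R p_pr p_odd)).
rewrite gauss_sum_prime // exprMn -exprM powR_half rmorphXn subn1 !mulrA.
congr (_ * _ ^+ _ * _).
(* The division by [4] is exact, with quotient [p./2 ^ 2 * n]. *)
have -> : (p - 1 = 2 * p./2)%N by rewrite -[p in LHS]odd_double_half p_odd; lia.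
by rewrite expnMn -mulnA mulKn.
Qed.

Lemma even_degree_exp_sum (a : F) (m s : nat) :
  a != 0 -> (0 < m)%N -> n = (m * (2 * s))%N ->
  exp_sum R p n (fun x => a * x ^+ (p ^ m).+1)
  = (- (p ^ m)%:R) ^+ (s + (a ^+ ((p ^ m).-1 * ((p ^ n).-1 %/ (p ^ (2 * m)).-1))
                            == (-1) ^+ s)).
Proof.
move=> a0 m0 nE; rewrite exp_sumE.
have cF : #|F| = (((p ^ m) ^ 2) ^ s)%N by rewrite cardF nE -!expnM mulnA.
rewrite (herm_sum_even_degree psiC chF p_odd _ m0 a0 cF); last first.
  by move=> x; apply: addchar_trace_frob p_pr cardF trE _ _ _.
by rewrite cardF [(2 * m)%N]mulnC expnM.
Qed.

End MonomialSums.

(** For odd [t], [Q ^ t - 1] and [Q - 1] agree modulo [Q ^ 2 - 1], whose multiples yield exponents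
    divisible by [#|F| - 1]. This replaces [p ^ alpha] by [p ^ m] in the criterion on [a]. *)
Lemma expf_odd_exponent (F : finFieldType) (a : F) (Q t : nat) :
  a != 0 -> (0 < Q)%N -> odd t -> ((Q ^ 2).-1 %| #|F|.-1)%N ->
  a ^+ ((Q ^ t).-1 * (#|F|.-1 %/ (Q ^ 2).-1))
  = a ^+ (Q.-1 * (#|F|.-1 %/ (Q ^ 2).-1)).
Proof.
move=> a0 Q_gt0 t_odd dv; set k := (_ %/ _)%N.
have /dvdnP[z zE] := dvdn_pred_expn (Q ^ 2) t./2.
have X_gt0 : (0 < (Q ^ 2) ^ t./2)%N by rewrite !expn_gt0 Q_gt0.
have -> : ((Q ^ t).-1 = Q.-1 + (Q ^ 2).-1 * (Q * z))%N.
  rewrite -[t in LHS]odd_double_half t_odd add1n expnS -mul2n expnM.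
  rewrite [RHS](_ : _ = Q.-1 + Q * (z * (Q ^ 2).-1))%N; last first.
    by rewrite mulnCA [(z * _)%N]mulnC mulnCA.
  rewrite -zE; case: (_ ^ _)%N X_gt0 => // X _.
  by case: (Q) Q_gt0 => // Q' _; lia.
rewrite mulnDl exprD -[RHS]mulr1; congr (_ * _).
rewrite mulnAC mulnC (_ : _ * _ = #|F|.-1 * (Q * z))%N; last first.
  by rewrite mulnC /k; congr (_ * _)%N; rewrite mulnC divnK.
by rewrite exprM finField_expf_pred // expr1n.
Qed.

Theorem corollary7p6 (R : realType) (F : finFieldType) (p n alpha : nat)
    (a : F) (p_prime : prime p) (p_odd : odd p) (n_ge1 : (1 <= n)%N)
    (cardF : #|F| = (p ^ n)%N) (a_neq0 : a != 0) :
  let S : R[i] := exp_sum R p n (fun x : F => a * x ^+ (p ^ alpha + 1)) in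
  let d := gcdn (2 * alpha) n in
  let e := ((p ^ alpha - 1) * (p ^ n - 1) %/ (p ^ d - 1))%N in
  [/\ (nu2 n <= nu2 alpha)%E ->
        S = (quad_char a)%:~R * (-1) ^+ (n - 1)
            * 'i%C ^+ ((p - 1) ^ 2 * n %/ 4)
            * (p%:R `^ (n%:R / 2))%:C,
      nu2 n = (nu2 alpha + 1)%E ->
        S = if a ^+ e == -1 then (p%:R `^ ((n + d)%:R / 2))%:C
            else - (p%:R `^ (n%:R / 2))%:C
    & (nu2 alpha + 1 < nu2 n)%E ->
        S = if a ^+ e == 1 then - (p%:R `^ ((n + d)%:R / 2))%:C
            else (p%:R `^ (n%:R / 2))%:C].
Proof.
move=> S d e.
have p_gt0 := prime_gt0 p_prime.
have nu_n : nu2 n = (logn 2 n)%:Z%:E by rewrite /nu2 gtn_eqF.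
(* Cases (ii) and (iii) are treated at once: [s1] is the parity of [s], true in (ii) and false in
   (iii). *)
have even_case : (0 < alpha)%N -> (logn 2 alpha < logn 2 n)%N ->
    let s1 := logn 2 n == (logn 2 alpha).+1 in
    S = if a ^+ e == (-1) ^+ s1 then (-1) ^+ s1.+1 * (p%:R `^ ((n + d)%:R / 2))%:C
        else (-1) ^+ s1 * (p%:R `^ (n%:R / 2))%:C.
  move=> alpha_gt0 lt_log s1.
  have [m [t [s [[aE nE m_gt0 t_odd] [co dE sE]]]]] :=
    two_adic_split n_ge1 alpha_gt0 lt_log.
  have Q_gt0 : (0 < p ^ m)%N by rewrite expn_gt0 p_gt0.
  have Q2E : ((p ^ m) ^ 2 = p ^ (2 * m))%N by rewrite mulnC expnM.
  have dv : (((p ^ m) ^ 2).-1 %| #|F|.-1)%N.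
    by rewrite cardF nE mulnA [(m * 2)%N]mulnC expnM Q2E dvdn_pred_expn.
  have SE : S = exp_sum R p n (fun x => a * x ^+ (p ^ m).+1).
    rewrite /S addn1; apply: exp_sum_gcd => //.
    rewrite aE nE gcdn_expn_succ_pred //.
    have := @gcdn_expn_succ_pred p m 1 s p_gt0 isT (coprime1n _).
    by rewrite muln1 => ->.
  have eE : a ^+ e = a ^+ ((p ^ m).-1 * ((p ^ n).-1 %/ (p ^ (2 * m)).-1)).
    rewrite -cardF -Q2E -(expf_odd_exponent a_neq0 Q_gt0 t_odd dv).
    by rewrite /e /d dE !subn1 -muln_divA -?Q2E -?cardF // aE expnM.
  rewrite SE (even_degree_exp_sum R p_prime p_odd cardF a_neq0 m_gt0 nE) -eE.
  have -> : (-1) ^+ s = (-1) ^+ s1 :> F by rewrite -signr_odd sE.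
  rewrite /d dE exprNn -signr_odd oddD sE -/s1.
  (* Both [n] and [n + d] are even, so the real powers of [p] are the integers [Q ^ s] and
     [Q ^ (s + 1)] with [Q = p ^ m]. *)
  have nd : (n + 2 * m = 2 * (m * s.+1))%N by rewrite nE; lia.
  have n2 : n = (2 * (m * s))%N by rewrite nE mulnCA.
  rewrite nd [in X in _ = if _ then _ else X]n2 !powR_half_double !rmorph_nat.
  rewrite -natrX -expnM; case: (_ == _); last by rewrite addn0 addbF.
  by rewrite addn1 addbT signrN exprS mulN1r.
split.
- rewrite nu_n => nu_le; rewrite /S addn1 (exp_sum_gcd R cardF _ (l := 2)) //.
    exact: quad_exp_sum.
  (* Here [t] is the odd part of [n]; the valuation hypothesis says that the power of [2] in [n]
     divides [alpha], so [n] divides [alpha * t]. *)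
  have [t] := pfactor_coprime (isT : prime 2) n_ge1; rewrite coprime2n => t_odd nE.
  rewrite (@gcdn_expn_succ_pred2 p n alpha t) //.
    (* The exponent [2] is [p ^ 0 + 1]. *)
    by have := @gcdn_expn_succ_pred2 p n 0 1 p_odd n_ge1 isT (dvdn0 n); rewrite expn0.
  rewrite {1}nE mulnC dvdn_mul //.
  have [->|a_gt0] := posnP alpha; first exact: dvdn0.
  by move: nu_le; rewrite /nu2 gtn_eqF // lee_fin lez_nat pfactor_dvdn.
- rewrite nu_n => nu_eq.
  (* For [alpha = 0] the valuation is infinite, which the finite valuation of [n] excludes. *)
  have [a0|a_gt0] := posnP alpha.
    by move: nu_eq; rewrite a0 /nu2 eqxx.
  have log_eq : logn 2 n = (logn 2 alpha).+1.
    by move: nu_eq; rewrite /nu2 gtn_eqF // -EFinD => -[]; lia.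
  have := even_case a_gt0; rewrite log_eq eqxx => /(_ (leqnn _)) ->.
  by rewrite expr1 sqrrN expr1n mul1r mulN1r.
rewrite nu_n => nu_lt.
have [a0|a_gt0] := posnP alpha.
  by move: nu_lt; rewrite a0 /nu2 eqxx.
have log_lt : ((logn 2 alpha).+1 < logn 2 n)%N.
  by move: nu_lt; rewrite /nu2 gtn_eqF // -EFinD lte_fin; lia.
have := even_case a_gt0 (ltnW log_lt); rewrite gtn_eqF // => ->.
by rewrite expr0 expr1 mulN1r mul1r.
Qed.
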